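(* Under all the assumptions listed in the context, let $\alpha$ be a fixed constant with $\max(1-4\alpha_0,0)<\alpha<1$ and set $$\Omega_n=\Big\{\omega\in\Omega:\ |\hat\lambda-\lambda|\le\frac{\lambda}{\|\mathbf{N}(n)\|^{\frac{1-\alpha}{2}}}\Big\}.$$ Then there is a constant $C$, independent of $n$, with $\mathbb{P}(\Omega_n)\ge1-C\|\mathbf{N}(n)\|^{-\alpha}$, and $\overline{\mathrm{MISE}}$ is asymptotically equivalent to $\mathrm{MISE}$ on the events $\Omega_n$, that is, $$\lim_{\|\mathbf{N}(n)\|\to\infty}\frac{\overline{\mathrm{MISE}}[p,\hat p\,|\,\Omega_n]}{\mathrm{MISE}[p,\hat p\,|\,\Omega_n]}=1 .$$
   Context: Fix an integer $M\ge1$ and probability densities $p_1,\dots,p_M$ on $\mathbb{R}$; put $p^*(x)=\prod_{m=1}^Mp_m(x)$, $\lambda=\int_{\mathbb{R}}p^*(x)\,dx$ (assumed $>0$), and $p=\lambda^{-1}p^*$. On a probability space $(\Omega,\mathbb{P})$, for each $m$ let $X^m_1,\dots,X^m_{N_m}$ be i.i.d. with density $p_m$, the samples for different $m$ being independent, and let $$\hat p_m(x)=\frac1{N_mh_m}\sum_{i=1}^{N_m}K\Big(\frac{x-X_i^m}{h_m}\Big),\qquad \hat p^*(x)=\prod_{m=1}^M\hat p_m(x),\qquad\hat\lambda=\int_{\mathbb{R}}\hat p^*(x)\,dx,\qquad \hat p=\hat\lambda^{-1}\hat p^*,$$ with kernel $K$ and bandwidths $h_m>0$. Write $\mathbf{N}=(N_1,\dots,N_M)$,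 $\mathbf{h}=(h_1,\dots,h_M)$; $\|\cdot\|$ is a fixed norm on $\mathbb{R}^M$. The conditional functionals are $$\mathrm{MISE}[p,\hat p\,|\,\Omega_n]=\frac1{\mathbb{P}(\Omega_n)}\int_{\Omega_n}\int_{\mathbb{R}}(\hat p(x,\omega)-p(x))^2dx\,\mathbb{P}(d\omega),$$ $$\overline{\mathrm{MISE}}[p,\hat p\,|\,\Omega_n]=\frac1{\mathbb{P}(\Omega_n)}\int_{\Omega_n}\Big(\frac{\hat\lambda}{\lambda}\Big)^2\int_{\mathbb{R}}(\hat p(x,\omega)-p(x))^2dx\,\mathbb{P}(d\omega).$$ Assumptions: - Kernel: $0\le K\le C_K$ for some constant $C_K$, $\int K=1$, $\int tK(t)\,dt=0$, $\int K^2<\infty$, and $\int_{\mathbb{R}}|t|^sK(t)\,dt<\infty$ for $s\in\{0,1,2,3\}$. - Densities: for each $m$, $p_m\in C^3(\mathbb{R})$, and $p_m^{(s)}$ is bounded on $\mathbb{R}$ and integrable on $\mathbb{R}$ for each $s\in\{0,1,2,3\}$. - Scaling: $\mathbf{N}=\mathbf{N}(n)\in\mathbb{N}^M$ and $\mathbf{h}=\mathbf{h}(n)\in(0,\infty)^M$ are functions of $n\in\mathbb{N}$ such that for all $i$: $D_1\le N_i(n)/n\le D_2$ for some $0<D_1<D_2$; $A_1N_i(n)^{-\alpha_0}\le h_i(n)\le A_2N_i(n)^{-\alpha_0}$ for some $A_1,A_2>0$ and some $\alpha_0\in(0,1)$; and $\lim_{n\to\infty}h_i(n)N_i(n)=\infty$.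 *)

(* Defs.v *)
From HB Require Import structures.
From mathcomp Require Import all_boot all_order all_algebra.
From mathcomp Require Import all_classical all_reals all_analysis.

Set Implicit Arguments.
Unset Strict Implicit.
Unset Printing Implicit Defensive.

Import Order.TTheory GRing.Theory Num.Theory.
Import numFieldNormedType.Exports.

Local Open Scope classical_set_scope.
Local Open Scope ring_scope.

Record is_norm (R : realType) (M : nat) (nrm : 'rV[R]_M -> R) : Prop := IsNorm {
  norm_ge0 : forall v, 0 <= nrm v;
  norm_eq0 : forall v, nrm v = 0 -> v = 0;
  norm_scale : forall (a : R) v, nrm (a *: v) = `|a| * nrm v;
  norm_triangle : forall u v, nrm (u + v) <= nrm u + nrm v }.

Record kernel_assumption (R : realType) (K : R -> R) : Prop := KernelAssumption {
  kernel_measurable : measurable_fun [set: R] K;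
  kernel_bounded : exists CK : R, forall t, 0 <= K t <= CK;
  kernel_mass : (\int[lebesgue_measure]_t (K t)%:E = 1)%E;
  kernel_centered : (\int[lebesgue_measure]_t (t * K t)%:E = 0)%E;
  kernel_square : (\int[lebesgue_measure]_t (K t ^+ 2)%:E < +oo)%E;
  kernel_moments : forall s, (s <= 3)%N ->
    (\int[lebesgue_measure]_t (`|t| ^+ s * K t)%:E < +oo)%E }.

Definition is_density (R : realType) (f : R -> R) : Prop :=
  [/\ measurable_fun [set: R] f, forall x, 0 <= f x &
      (\int[lebesgue_measure]_x (f x)%:E = 1)%E].

(* Continuity of the lower derivatives follows from their derivability. *)
Definition class_C (R : realType) (k : nat) (f : R -> R) : Prop :=
  (forall s x, (s < k)%N -> derivable (derive1n s f) x 1) /\ continuous (derive1n k f).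

Definition density_assumption (R : realType) (f : R -> R) : Prop :=
  [/\ is_density f, class_C 3 f &
      forall s, (s <= 3)%N ->
        bounded_fun (derive1n s f) /\
        lebesgue_measure.-integrable [set: R] (EFin \o derive1n s f)].

(* The sequences are indexed by n >= 1; their values at n = 0 are irrelevant. *)
Record scaling_assumption (R : realType) (M : nat) (N : nat -> 'I_M -> nat)
    (h : nat -> 'I_M -> R) (alpha0 : R) : Prop := ScalingAssumption {
  scaling_exponent : 0 < alpha0 < 1;
  scaling_bandwidth_gt0 : forall n i, (0 < n)%N -> 0 < h n i;
  scaling_size : exists D1 D2 : R, 0 < D1 < D2 /\
    forall n i, (0 < n)%N -> D1 <= (N n i)%:R / n%:R <= D2;
  scaling_bandwidth : exists A1 A2 : R, [/\ 0 < A1, 0 < A2 &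
    forall n i, (0 < n)%N ->
      A1 * (N n i)%:R `^ (- alpha0) <= h n i <= A2 * (N n i)%:R `^ (- alpha0)];
  scaling_limit : forall i, h n i * (N n i)%:R @[n --> \oo] --> +oo }.

Definition mutually_independent d (Omega : measurableType d) (R : realType)
    (P : probability Omega R) (I : finType) (Y : I -> {RV P >-> R}) : Prop :=
  forall (J : {set I}) (A : I -> set R), (forall i, measurable (A i)) ->
    (P (\bigcap_(i in [set j | j \in J]) (Y i @^-1` A i)) =
     \prod_(i in J) P (Y i @^-1` A i))%E.

Definition has_density d (Omega : measurableType d) (R : realType)
    (P : probability Omega R) (Y : {RV P >-> R}) (f : R -> R) : Prop :=
  forall A : set R, measurable A ->
    (distribution P Y A = \int[lebesgue_measure]_(x in A) (f x)%:E)%E.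

Definition sample_assumption d (Omega : measurableType d) (R : realType)
    (P : probability Omega R) (M : nat) (p : 'I_M -> R -> R) (N : 'I_M -> nat)
    (X : forall m, 'I_(N m) -> {RV P >-> R}) : Prop :=
  (forall m i, has_density (X m i) (p m)) /\
  mutually_independent (fun k : {m : 'I_M & 'I_(N m)} => X (tag k) (tagged k)).

Definition pointwise_prod (R : realType) (M : nat) (f : 'I_M -> R -> R) (x : R) : R :=
  \prod_(m < M) f m x.

Definition mass (R : realType) (f : R -> R) : R :=
  \int[lebesgue_measure]_x f x.

Definition normalized (R : realType) (f : R -> R) (x : R) : R :=
  (mass f)^-1 * f x.

Definition kde (R : realType) (K : R -> R) (N : nat) (h : R) (xs : 'I_N -> R) (x : R) : R :=
  (N%:R * h)^-1 * \sum_(i < N) K ((x - xs i) / h).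

(* The unnormalised product estimator built from the data observed at w. *)
Definition estimator d (Omega : measurableType d) (R : realType)
    (P : probability Omega R) (M : nat) (K : R -> R) (N : 'I_M -> nat)
    (h : 'I_M -> R) (X : forall m, 'I_(N m) -> {RV P >-> R}) (w : Omega) : R -> R :=
  pointwise_prod (fun m => kde K (h m) (fun i => X m i w)).

Definition ISE (R : realType) (f g : R -> R) : \bar R :=
  (\int[lebesgue_measure]_x ((g x - f x) ^+ 2)%:E)%E.

(* Conditional functionals on the event E, for the target p = normalized pstar
   and the estimator phat = normalized pstarhat. *)
Definition MISE d (Omega : measurableType d) (R : realType)
    (P : probability Omega R) (pstar : R -> R) (pstarhat : Omega -> R -> R)
    (E : set Omega) : \bar R :=
  ((P E)^-1 *
   \int[P]_(w in E) ISE (normalized pstar) (normalized (pstarhat w)))%E.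

Definition MISEbar d (Omega : measurableType d) (R : realType)
    (P : probability Omega R) (pstar : R -> R) (pstarhat : Omega -> R -> R)
    (E : set Omega) : \bar R :=
  ((P E)^-1 *
   \int[P]_(w in E) (((mass (pstarhat w) / mass pstar) ^+ 2)%:E *
                     ISE (normalized pstar) (normalized (pstarhat w))))%E.

Definition size_norm (R : realType) (M : nat) (nrm : 'rV[R]_M -> R)
    (N : 'I_M -> nat) : R :=
  nrm (\row_(m < M) (N m)%:R).

Definition good_event (Omega : Type) (R : realType) (pstar : R -> R)
    (pstarhat : Omega -> R -> R) (alpha : R) (r : R) : set Omega :=
  [set w | `|mass (pstarhat w) - mass pstar| <=
           mass pstar / r `^ ((1 - alpha) / 2)].

(* The filter on {n | 1 <= n} for which "s n tends to infinity". *)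
Definition tends_to_infinity (R : realType) (s : nat -> R) : set_system nat :=
  filter_from [set: R] (fun T => [set n | (0 < n)%N /\ T < s n]).

(* Main.v *)
Require Import Defs.
From HB Require Import structures.
From mathcomp Require Import all_boot all_order all_algebra.
From mathcomp Require Import all_classical all_reals all_analysis measurable_realfun.
From mathcomp Require Import ring lra.
Set Implicit Arguments.
Unset Strict Implicit.
Unset Printing Implicit Defensive.
Import Order.TTheory GRing.Theory Num.Theory.
Import numFieldNormedType.Exports.
Local Open Scope classical_set_scope.
Local Open Scope ring_scope.

(** Write [Z] for the random mass of the product estimator, [lambda] for the mass
    of the product of the densities and [r] for the norm of the sample sizes. On
    the event of the statement, [Z / lambda] is within [eps = r ^ (- (1 - alpha) / 2)]
    of 1. So the weight in the numerator is between [(1 - eps) ^ 2] and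
    [(1 + eps) ^ 2], and so is the quotient of the two functionals, as soon as the
    event has positive probability and the integral of the integrated squared
    error over it is neither zero nor infinite ([weighted_ratio_bounds]). As [eps]
    tends to 0 when [r] tends to infinity, three facts are needed.

    Probability of the event ([good_event_probability]). The mean of [Z] is the mass
    of the product of the smoothed densities [s_m], the convolutions of the [p_m]
    with the scaled kernels. Its second moment is the double integral of
    the product over [m] of the mean of [phat_m(x) phat_m(y)], and this mean is at most
    [s_m(x) s_m(y) + q_m(x, y) / N_m], where [q_m] has integral 1 and [q_m / N_m] is
    bounded because [N_m h_m] is bounded below. Expanding the product, every term
    but the first keeps one factor [q_m / N_m], so the variance of [Z] is
    of order [1 / n] ([second_moment_mass]). As the kernel is centered, [s_m - p_m] is of
    order [h_m ^ 2] ([smoothed_bias]), and so is the difference between the mean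
    of [Z] and [lambda]; for one group both are equal to 1. The condition
    [alpha > 1 - 4 alpha0] makes this bias negligible before the tolerance, and the
    inequality of Chebyshev concludes.

    Finiteness ([ISE_le]). The kernel and the densities are bounded, and [Z] is
    bounded below on the event.

    Positivity ([integral_ISE_gt0]). If the error vanishes then the normalized
    estimate equals the target almost everywhere, so the first moment of the
    estimate is [kappa * Z] for a fixed [kappa]. Translating all samples by [t] does not
    change [Z] and adds [t * Z] to the first moment ([first_moment_shift]); so every
    line of translations contains at most one such configuration. By Tonelli, the
    samples translated by [t] almost surely avoid these configurations, for almost
    every [t]. When [t] tends to 0 the law of the translated samples tends to that
    of the samples in total variation, because the densities are continuous; hence
    the samples themselves almost surely avoid them ([translation_null]).

    Independence enters through the invariance of the joint law when a block of
    samples is replaced by an independent copy ([integral_joint_splice]). *)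

(** * Configurations of finitely many real coordinates *)

Section configurations.
Context (R : realType) (I : finType).
Implicit Types (A : I -> set R) (y z : I -> R).

Definition box A : set (I -> R) := [set y | forall k, A k (y k)].

Definition boxes : set (set (I -> R)) :=
  [set box A | A in [set A | forall k, measurable (A k)]].

(** Boxes are stable under intersection, so that a law on configurations is
    determined by its values on boxes; this is how independence enters. *)
Definition config := g_sigma_algebraType boxes.
HB.instance Definition _ := Measurable.on config.

Lemma measurable_preimage_box d (T : measurableType d) (f : T -> config) A :
  (forall k, measurable_fun [set: T] (fun t => f t k : R)) ->
  (forall k, measurable (A k)) -> measurable (f @^-1` box A).
Proof.
move=> mf mA.
rewrite (_ : _ @^-1` _ = \bigcap_(k in [set: I]) ((fun t => f t k : R) @^-1` A k)).
  apply: fin_bigcap_measurable => [|k _]; first exact: finite_finset.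
  by rewrite -[X in measurable X]setTI; exact: mf.
by apply/seteqP; split => t /= h k; [move=> _|]; exact: h.
Qed.

Lemma measurable_config d (T : measurableType d) (f : T -> config) :
  (forall k, measurable_fun [set: T] (fun t => f t k : R)) ->
  measurable_fun [set: T] f.
Proof.
move=> mf; apply: (@measurability _ _ _ config _ f boxes) => // _ [_ [A mA <-] <-].
by rewrite setTI; exact: measurable_preimage_box.
Qed.

Lemma measurable_coord k : measurable_fun [set: config] (fun y : config => y k : R).
Proof.
move=> _ B mB; rewrite setTI; apply: sub_sigma_algebra.
exists (fun j => if j == k then B else setT).
  by move=> j /=; case: ifP.
apply/seteqP; split => y /=.
  by move=> /(_ k); rewrite eqxx.
by move=> By j; case: eqP => // ->.
Qed.

Definition splice (B : pred I) y z : I -> R := fun k => if B k then y k else z k.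

Lemma setI_closed_boxes : setI_closed boxes.
Proof.
move=> _ _ [A mA <-] [B mB <-]; exists (fun k => A k `&` B k).
  by move=> k; exact: measurableI.
apply/seteqP; split => y /=; last by move=> [h1 h2] k; split.
by move=> h; split=> k; have [] := h k.
Qed.

End configurations.

(** * Independence and resampling of a block of coordinates *)

Section independence.
Context d (Omega : measurableType d) (R : realType) (P : probability Omega R).
Context (I : finType) (Y : I -> {RV P >-> R}).
Hypothesis indepY : mutually_independent Y.

Definition joint (w : Omega) : config R I := fun k => Y k w.

Lemma measurable_joint : measurable_fun [set: Omega] joint.
Proof. by apply: measurable_config => k; exact: measurable_funP. Qed.

Lemma joint_box (A : I -> set R) : (forall k, measurable (A k)) ->
  P (joint @^-1` box A) = (\prod_k P (Y k @^-1` A k))%E.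
Proof.
move=> mA; have := indepY [set: I]%SET mA.
rewrite (eq_bigl xpredT) => [<-|k]; last by rewrite inE.
congr (P _); apply/seteqP; split => w /= h k; first by move=> _; exact: h.
by apply: (h k); rewrite /= inE.
Qed.

Local Open Scope ereal_scope.

Let msplice (B : pred I) :
  measurable_fun [set: Omega * Omega] (fun w => splice B (joint w.1) (joint w.2) : config R I).
Proof.
apply: measurable_config => k; rewrite /splice; case: (B k).
  exact: (measurableT_comp (measurable_funP (Y k)) measurable_fst).
exact: (measurableT_comp (measurable_funP (Y k)) measurable_snd).
Qed.

(** On a box, the probability that the spliced configuration lies in it factors
    into the product over [B] and the product over the complement, exactly as
    independence prescribes for the original family. So replacing the coordinates
    outside [B] by an independent copy does not change the joint law. Every use of
    independence below goes through this fact. *)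
Lemma integral_joint_splice (B : pred I) (F : config R I -> \bar R) :
  measurable_fun [set: config R I] F -> (forall y, 0 <= F y) ->
  \int[P]_w F (joint w) =
  \int[P]_w \int[P]_w' F (splice B (joint w) (joint w')).
Proof.
move=> mF F0.
pose f := fun w : Omega * Omega => splice B (joint w.1) (joint w.2) : config R I.
have mf : measurable_fun [set: Omega * Omega] f by exact: msplice.
pose J : {mfun Omega >-> config R I} :=
  HB.pack joint (isMeasurableFun.Build _ _ _ _ _ measurable_joint).
pose f' : {mfun (Omega * Omega)%type >-> config R I} :=
  HB.pack f (isMeasurableFun.Build _ _ _ _ _ mf).
have eqd (S : set (config R I)) : measurable S ->
    distribution P J S = distribution (P \x P) f' S.
  move=> mS; apply: (@measure_unique _ R (config R I) (@boxes R I) (fun _ => setT)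
    _ _ _ _ (distribution P J) (distribution (P \x P) f') _ _ S mS) => //.
  - exact: setI_closed_boxes.
  - by move=> _; exists (fun _ => setT) => //; apply/seteqP; split.
  - by rewrite bigcup_const //; exists 0%N.
  - move=> _ [A mA <-]; rewrite /= /distribution /pushforward.
    pose AB (b : bool) k := if B k == b then A k else setT.
    have -> : f @^-1` box A = (joint @^-1` box (AB true)) `*` (joint @^-1` box (AB false)).
      apply/seteqP; split => -[w w'] /=; rewrite /f /splice /AB /=.
        by move=> h; split=> k; have := h k; case: (B k).
      by move=> [h1 h2] k; have := h1 k; have := h2 k; case: (B k).
    have mAB b k : measurable (AB b k) by rewrite /AB; case: ifP.
    rewrite product_measure1E; [|exact: (measurable_preimage_box _ (mAB _)) ..];
      try by move=> k; exact: measurable_funP.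
    rewrite joint_box//.
    apply: (eq_trans _ (esym (congr2 mule (joint_box (mAB true)) (joint_box (mAB false))))).
    rewrite -big_split/=; apply: eq_bigr => k _; rewrite /AB.
    by case: (B k) => /=; rewrite preimage_setT probability_setT ?mule1 ?mul1e.
  - by move=> _; rewrite (le_lt_trans (probability_le1 _ _)) ?ltry.
transitivity (\int[distribution P J]_y F y).
  by rewrite ge0_integral_distribution.
transitivity (\int[distribution (P \x P) f']_y F y).
  by apply: eq_measure_integral => S mS _; exact: eqd.
rewrite ge0_integral_distribution//= fubini_tonelli1//=.
exact: measurableT_comp.
Qed.

End independence.

(** * Expectations of functions of disjoint blocks *)

Section independence_consequences.
Local Open Scope ereal_scope.
Context d (Omega : measurableType d) (R : realType) (P : probability Omega R).
Context (I : finType) (Y : I -> {RV P >-> R}).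
Hypothesis indepY : mutually_independent Y.

Definition depends_on (S : Type) (B : pred I) (F : (I -> R) -> S) :=
  forall y z, (forall k, B k -> y k = z k) -> F y = F z.

(** After splicing, one factor only sees the first copy and the other only
    the second, and the double integral splits. *)
Lemma expectation_mul_blocks (B : pred I) (F G : config R I -> \bar R) :
  measurable_fun [set: config R I] F -> (forall y, 0 <= F y) ->
  measurable_fun [set: config R I] G -> (forall y, 0 <= G y) ->
  depends_on B F -> depends_on (predC B) G ->
  \int[P]_w (F (joint Y w) * G (joint Y w)) =
  \int[P]_w F (joint Y w) * \int[P]_w G (joint Y w).
Proof.
move=> mF F0 mG G0 FB GB.
have mY := measurable_joint Y.
rewrite (integral_joint_splice indepY B (F := fun y => F y * G y)); last 2 first.
- exact: emeasurable_funM.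
- by move=> y; exact: mule_ge0.
rewrite -ge0_integralZr//=; last 2 first.
- exact: measurableT_comp mF mY.
- exact: integral_ge0.
apply: eq_integral => w _; rewrite -ge0_integralZl//=; last first.
  exact: measurableT_comp mG mY.
apply: eq_integral => w' _; congr (_ * _).
  by apply: FB => k Bk; rewrite /splice Bk.
by apply: GB => k /= /negbTE Bk; rewrite /splice Bk.
Qed.

Lemma expectation_prod_blocks (J : finType) (b : I -> J)
    (F : J -> config R I -> \bar R) :
  (forall j, measurable_fun [set: config R I] (F j)) ->
  (forall j y, 0 <= F j y) ->
  (forall j, depends_on [pred k | b k == j] (F j)) ->
  \int[P]_w (\prod_j F j (joint Y w)) = \prod_j \int[P]_w F j (joint Y w).
Proof.
move=> mF F0 FB.
have mprod s : measurable_fun [set: config R I] (fun y => \prod_(j <- s) F j y).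
  elim: s => [|j s ih].
    apply: (eq_measurable_fun (cst 1)) => [y _|]; first by rewrite big_nil.
    exact: measurable_cst.
  apply: (eq_measurable_fun (fun y => F j y * \prod_(i <- s) F i y)) => [y _|].
    by rewrite big_cons.
  exact: emeasurable_funM.
have prod0 s y : 0 <= \prod_(j <- s) F j y by apply: prode_ge0.
suff H s : uniq s ->
    \int[P]_w (\prod_(j <- s) F j (joint Y w)) = \prod_(j <- s) \int[P]_w F j (joint Y w).
  by apply: H; exact: index_enum_uniq.
elim: s => [_|j s ih /= /andP[js us]].
  under eq_integral do rewrite big_nil.
  rewrite big_nil integral_cst// mul1e; exact: probability_setT.
under eq_integral do rewrite big_cons.
rewrite big_cons -ih//.
apply: (expectation_mul_blocks (B := [pred k | b k == j]) (F := F j)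
  (G := fun y => \prod_(i <- s) F i y)) => //.
move=> y z yz; rewrite big_seq [RHS]big_seq; apply: eq_bigr => i si.
apply: FB => k /= /eqP bki; apply: yz => /=; rewrite bki.
by apply: contraNneq js => <-.
Qed.

Definition update (y : I -> R) (k : I) (x : R) : I -> R :=
  fun j => if j == k then x else y j.

(** Splicing along a single coordinate: that coordinate can be integrated
    separately, the others being frozen. Used to move one sample at a time. *)
Lemma expectation_update (k : I) (F : config R I -> \bar R) :
  measurable_fun [set: config R I] F -> (forall y, 0 <= F y) ->
  \int[P]_w F (joint Y w) = \int[P]_w \int[P]_w' F (update (joint Y w') k (Y k w)).
Proof.
move=> mF F0; rewrite (integral_joint_splice indepY (pred1 k) mF F0).
apply: eq_integral => w _; apply: eq_integral => w' _; congr (F _).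
by apply/funext => j; rewrite /splice /update /=; case: eqP => // ->.
Qed.

End independence_consequences.

(** * Random variables with a density *)

Section density.
Local Open Scope ereal_scope.
Context d (Omega : measurableType d) (R : realType) (P : probability Omega R).
Context (Y : {RV P >-> R}) (f : R -> R).
Hypotheses (mf : measurable_fun [set: R] f) (f0 : forall x, (0 <= f x)%R).
Hypothesis Yf : has_density Y f.
Let mu := @lebesgue_measure R.

Import HBNNSimple.

Let density_nnsfun (g : {nnsfun R >-> R}) :
  \int[distribution P Y]_x (g x)%:E = \int[mu]_x ((g x)%:E * (f x)%:E).
Proof.
have mg r : measurable (g @^-1` [set r]) by [].
under [LHS]eq_integral do rewrite fimfunE -fsumEFin//.
rewrite [LHS]ge0_integral_fsum//; last 2 first.
  - by move=> r; exact/measurable_EFinP/measurableT_comp.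
  - by move=> n x _; rewrite EFinM nnfun_muleindic_ge0.
under [RHS]eq_integral.
  move=> x xD; rewrite fimfunE -fsumEFin// ge0_mule_fsuml; last first.
    by move=> r; rewrite EFinM nnfun_muleindic_ge0.
  over.
rewrite [RHS]ge0_integral_fsum//; last 2 first.
  - move=> r; apply: emeasurable_funM; last exact/measurable_EFinP.
    apply/measurable_EFinP; apply: measurable_funM; first exact: measurable_cst.
    exact: (measurable_indic (mg r)).
  - move=> n x _; rewrite EFinM mule_ge0//; first by rewrite nnfun_muleindic_ge0.
    by rewrite lee_fin.
apply: eq_fsbigr => r _; rewrite integralZl_indic_nnsfun//= integral_indic//= setIT.
rewrite (Yf (mg r)); have [r0|r0] := leP 0%R r; last first.
  rewrite preimage_nnfun0// integral_set0 mule0.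
  by rewrite integral0_eq// => x _; rewrite indic0 mulr0 mul0e.
rewrite -ge0_integralZl//=; last 3 first.
- exact: mg.
- exact/measurable_EFinP/measurable_funTS.
- by move=> x _; rewrite lee_fin.
rewrite [LHS]integral_mkcond; apply: eq_integral => x _.
rewrite patchE indicE; case: ifPn => _; first by rewrite mulr1.
by rewrite mulr0 mul0e.
Qed.

(** Both sides agree on indicators by assumption, hence on nonnegative simple
    functions, hence on their increasing limits. *)
Lemma expectation_density (g : R -> \bar R) :
  measurable_fun [set: R] g -> (forall x, 0 <= g x) ->
  \int[P]_w g (Y w) = \int[mu]_x (g x * (f x)%:E).
Proof.
move=> mg g0; rewrite -(ge0_integral_distribution Y)//.
pose g_ := nnsfun_approx measurableT mg.
have mg_ n : measurable_fun [set: R] (g_ n) by exact: measurable_funP.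
have nd_ m n x : (m <= n)%N -> (g_ m x <= g_ n x)%R.
  by move=> mn; exact/lefP/nd_nnsfun_approx.
transitivity (lim (\int[distribution P Y]_x (g_ n x)%:E @[n --> \oo])).
  rewrite -monotone_convergence//=.
  - apply: eq_integral => ? /[!inE] xD; apply/esym/cvg_lim => //=.
    exact: cvg_nnsfun_approx.
  - by move=> n; exact/measurable_EFinP/measurable_funTS.
  - by move=> n ? _; rewrite lee_fin.
  - by move=> ? _ ? ? mn; rewrite lee_fin; exact/lefP/nd_nnsfun_approx.
rewrite [RHS](_ : _ = lim (\int[mu]_x ((g_ n x)%:E * (f x)%:E) @[n --> \oo])).
  by apply: congr_lim; apply/funext => n /=; exact: density_nnsfun.
rewrite -monotone_convergence//=.
- apply: eq_integral => x _; apply/esym/cvg_lim => //; apply: cvgeZr => //.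
  exact: cvg_nnsfun_approx.
- by move=> n; apply: emeasurable_funM; apply/measurable_EFinP; [exact: mg_|exact: mf].
- by move=> n x _; rewrite mule_ge0 ?lee_fin.
- move=> x _ m n mn; rewrite lee_wpmul2r ?lee_fin//.
  exact: nd_.
Qed.

End density.

(** * Affine changes of variables for Lebesgue measure *)

Section affine_change_of_variables.
Local Open Scope ereal_scope.
Context (R : realType).
Let mu := @lebesgue_measure R.

Lemma ge0_integralN (f : R -> \bar R) :
  measurable_fun [set: R] f -> (forall x, 0 <= f x) ->
  \int[mu]_x f (- x)%R = \int[mu]_x f x.
Proof.
move=> mf f0; have mN : measurable_fun [set: R] (-%R : R -> measurableTypeR R).
  exact: oppr_measurable.
transitivity (\int[pushforward mu (-%R : R -> measurableTypeR R)]_x f x).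
  by rewrite ge0_integral_pushforward.
by apply: eq_measure_integral => /= A mA _; rewrite lebesgue_measureN.
Qed.

Lemma ge0_integral_pos_affine (f : R -> \bar R) (a b : R) : (0 < a)%R ->
  measurable_fun [set: R] f -> (forall x, 0 <= f x) ->
  \int[mu]_x f (a * x + b)%R = a^-1%:E * \int[mu]_x f x.
Proof.
move=> a0 mf f0.
have mphi : measurable_fun [set: R] (fun x => a * x + b : measurableTypeR R)%R.
  by apply: measurable_funD => //; exact: measurable_funM.
pose phi := (fun x => a * x + b : measurableTypeR R)%R.
pose nu0 : {measure set (measurableTypeR R) -> \bar R} :=
  measure_function_pushforward__canonical__measure_function_Measure mu mphi.
pose nu : {measure set (measurableTypeR R) -> \bar R} := mscale (NngNum (ltW a0)) nu0.
have H A : measurable A -> mu A = nu A.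
  apply: lebesgue_measure_unique => _ [[c e] _ <-].
  have phiK : phi @^-1` `]c, e]%classic = `]((c - b) / a)%R, ((e - b) / a)%R]%classic.
    apply/seteqP; split => x /=; rewrite !in_itv/= ltr_pdivrMr// ler_pdivlMr//;
      by rewrite ltrBlDr lerBrDr mulrC.
  change (lebesgue_measure `]c, e]%classic = a%:E * lebesgue_measure (phi @^-1` `]c, e]%classic)).
  rewrite phiK.
  rewrite !lebesgue_measure_itv/= !lte_fin ltr_pM2r ?invr_gt0// ltrD2r.
  case: ifPn => ce; last by rewrite mule0.
  rewrite -EFinM; congr (_%:E); rewrite -mulrBl mulrC mulfVK ?gt_eqF//; ring.
have -> : \int[mu]_x f x = \int[nu]_x f x.
  by apply: eq_measure_integral => /= A mA _; exact: H.
rewrite ge0_integral_mscale//= ge0_integral_pushforward//=.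
by rewrite muleA -EFinM mulVf ?mul1e// gt_eqF.
Qed.

Lemma ge0_integral_affine (f : R -> \bar R) (a b : R) : a != 0%R ->
  measurable_fun [set: R] f -> (forall x, 0 <= f x) ->
  \int[mu]_x f (a * x + b)%R = (`|a|^-1)%:E * \int[mu]_x f x.
Proof.
move=> a0 mf f0; case: (ltrgt0P a) a0 => // a0 _.
  exact: ge0_integral_pos_affine.
rewrite -(ge0_integral_pos_affine b _ mf f0) ?oppr_gt0//.
have mfa : measurable_fun [set: R] (fun x => f (- a * x + b)%R).
  by apply: (measurableT_comp mf); apply: measurable_funD => //; exact: measurable_funM.
rewrite -[RHS](ge0_integralN mfa)//.
by apply: eq_integral => x _; rewrite mulNr mulrN opprK.
Qed.

Lemma ge0_integral_shift (f : R -> \bar R) (t : R) :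
  measurable_fun [set: R] f -> (forall x, 0 <= f x) ->
  \int[mu]_x f (x + t)%R = \int[mu]_x f x.
Proof.
move=> mf f0; have := ge0_integral_pos_affine t ltr01 mf f0.
by under eq_integral do rewrite mul1r; rewrite invr1 mul1e.
Qed.

End affine_change_of_variables.

(** * Translating a density *)

Section translated_data.
Local Open Scope ereal_scope.
Context (R : realType).
Let mu := @lebesgue_measure R.

(** Only the coordinates listed in [s] move, so that a translation of the whole
    configuration can be performed one coordinate at a time. *)
Definition translate (I : eqType) (s : seq I) (t : R) (y : I -> R) : I -> R :=
  fun k => if k \in s then (y k + t)%R else y k.

(** The positive part of the difference between [f] and its translate; for two
    probability densities its integral is their distance in total variation. *)
Definition density_loss (f : R -> R) (t : R) : \bar R :=
  \int[mu]_x (Num.max (f x - f (x - t)) 0)%:E.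

(** Dominated convergence: the integrand tends to 0 pointwise by continuity and
    its values stay below [f]. *)
Lemma cvg_density_loss (f : R -> R) (t : nat -> R) :
  measurable_fun [set: R] f -> continuous f -> (forall x, (0 <= f x)%R) ->
  \int[mu]_x (f x)%:E < +oo -> t n @[n --> \oo] --> (0 : R)%R ->
  density_loss f (t n) @[n --> \oo] --> 0.
Proof.
move=> mf cf f0 foo t0.
have Fcvg (x : R) : (Num.max (f x - f (x - t n)) 0)%R @[n --> \oo] --> (0 : R)%R.
  rewrite [X in _ --> X](_ : _ = Num.max (f x - f (x - 0)) 0)%R; last by rewrite subr0 subrr
      maxxx.
  apply: (@continuous_cvg _ _ _ _ _ (fun n : nat => (f x - f (x - t n))%R) (fun z : R => (Num.max
      z 0)%R)).
    apply: (@continuous_max R R id (cst 0%R)); [exact: cvg_id|exact: cvg_cst].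
  apply: cvgB; first exact: cvg_cst.
  apply: (@continuous_cvg _ _ _ _ _ (fun n : nat => (x - t n)%R) f); first exact: cf.
  by apply: cvgB => //; exact: cvg_cst.
pose F n x := (Num.max (f x - f (x - t n)) 0)%:E : \bar R.
have [] := @dominated_convergence _ _ R mu setT measurableT F (cst 0) (EFin \o f).
- move=> n; apply/measurable_EFinP; apply: measurable_maxr => //.
  apply: measurable_funB => //; apply: measurableT_comp => //.
  exact: measurable_funB.
- exact: measurable_cst.
- apply: aeW => x _; rewrite /F /=; apply: (@cvg_EFin R nat \oo _ _ 0%R); first by apply: nearW.
  exact: Fcvg.
- apply/integrableP; split; first exact/measurable_EFinP.
  under eq_integral do rewrite gee0_abs ?lee_fin//.
  exact: foo.
- apply: aeW => x n _; rewrite /F /= lee_fin ger0_norm ?le_max ?lexx ?orbT//.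
  by rewrite ge_max f0 andbT lerBlDr lerDl.
- by move=> _ _; rewrite integral_cst// mul0e; exact.
Unshelve. all: by end_near.
Qed.

End translated_data.

(** * Translating independent samples *)

Section translated_samples.
Local Open Scope ereal_scope.
Context d (Omega : measurableType d) (R : realType) (P : probability Omega R).
Context (I : finType) (Y : I -> {RV P >-> R}) (f : I -> R -> R).
Hypothesis indepY : mutually_independent Y.
Hypothesis mf : forall k, measurable_fun [set: R] (f k).
Hypothesis f0 : forall k x, (0 <= f k x)%R.
Hypothesis Yf : forall k, has_density (Y k) (f k).
Let mu := @lebesgue_measure R.

Lemma measurable_translate (s : seq I) :
  measurable_fun [set: R * config R I] (fun x => translate s x.1 x.2 : config R I).
Proof.
apply: measurable_config => k; rewrite /translate; case: (k \in s).
  apply: measurable_funD; last exact: measurable_fst.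
  exact: (measurableT_comp (measurable_coord k) measurable_snd).
exact: (measurableT_comp (measurable_coord k) measurable_snd).
Qed.

Section fixed_event.
Context (A : set (config R I)) (mA : measurable A).

(** Freezing the coordinates other than [k], the probability of the event is an
    integral of some [g] with values in [0, 1] against the law of coordinate [k].
    Translating that coordinate replaces the density by its translate, and the
    integral of [g] drops by at most the integral of the positive part. *)
Lemma translate_one_more (s : seq I) (k : I) (t : R) : k \notin s ->
  \int[P]_w (\1_A (translate s t (joint Y w)))%:E <=
  \int[P]_w (\1_A (translate (k :: s) t (joint Y w)))%:E + density_loss (f k) t.
Proof.
move=> ks.
pose F s (y : config R I) := (\1_A (translate s t y : config R I) : R)%:E.
have mF u : measurable_fun [set: config R I] (F u).
  apply/measurable_EFinP; apply: (measurableT_comp (measurable_indic mA)).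
  exact: (measurable_fun_pair2 t (measurable_translate u)).
have F0 u y : 0 <= F u y by rewrite lee_fin.
have F1 u y : F u y <= 1 by rewrite lee_fin indicE; case: (_ \in _).
rewrite (expectation_update indepY k (mF s) (F0 s)).
rewrite (expectation_update indepY k (mF (k :: s)) (F0 (k :: s))).
pose g z := \int[P]_w F s (update (joint Y w) k z).
have mg : measurable_fun [set: R] g.
  apply: (measurable_fun_fubini_tonelli_F (fun x : R * Omega => F s (update (joint Y x.2) k
      x.1))) => [|x]; last exact: F0.
  apply: (measurableT_comp (mF s)).
  apply: measurable_config => j; rewrite /update; case: (j == k).
    exact: measurable_fst.
  exact: (measurableT_comp (measurable_funP (Y j)) measurable_snd).
have g0 z : 0 <= g z by apply: integral_ge0.
have g1 z : g z <= 1.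
  rewrite -[leRHS](probability_setT P) -[leRHS]mul1e -integral_cst//.
  apply: ge0_le_integral => //.
  apply: (measurableT_comp (mF s)); apply: measurable_config => j.
  rewrite /update; case: (j == k) => //; exact: measurable_funP.
under eq_integral => w _ do rewrite -/(g (Y k w)).
have -> : \int[P]_w \int[P]_w' F (k :: s) (update (joint Y w') k (Y k w)) =
    \int[P]_w g (Y k w + t)%R.
  apply: eq_integral => w _; apply: eq_integral => w' _; rewrite /F.
  congr ((\1_A _)%:E); apply/funext => j.
  by rewrite /translate /update inE; case: eqP => [->|//]; rewrite (negbTE ks).
have mgt : measurable_fun [set: R] (fun z => g (z + t)%R).
  by apply: (measurableT_comp mg); exact: measurable_funD.
rewrite (expectation_density (mf k) (f0 k) (Yf k) mg g0).
rewrite (expectation_density (mf k) (f0 k) (Yf k) mgt)//.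
have mft : measurable_fun [set: R] (fun x => f k (x - t)).
  by apply: (measurableT_comp (mf k)); exact: measurable_funB.
have mEf : measurable_fun [set: R] (EFin \o f k) by exact/measurable_EFinP.
have mEft : measurable_fun [set: R] (fun x => (f k (x - t))%:E) by exact/measurable_EFinP.
have m1 : measurable_fun [set: R] (fun x => g x * (f k (x - t))%:E) by exact: emeasurable_funM.
have m2 : measurable_fun [set: R] (fun x => g x * (f k x)%:E) by exact: emeasurable_funM.
have m3 : measurable_fun [set: R] (fun x => (Num.max (f k x - f k (x - t)) 0)%:E).
  apply/measurable_EFinP; apply: measurable_maxr => //; exact: measurable_funB.
have p1 x : 0 <= g x * (f k (x - t))%:E by rewrite mule_ge0 ?lee_fin.
have p2 x : 0 <= g x * (f k x)%:E by rewrite mule_ge0 ?lee_fin.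
have p3 x : 0 <= (Num.max (f k x - f k (x - t)) 0)%:E by rewrite lee_fin le_max lexx orbT.
have -> : \int[mu]_x (g (x + t)%R * (f k x)%:E) = \int[mu]_x (g x * (f k (x - t))%:E).
  rewrite -(ge0_integral_shift t m1)//.
  by apply: eq_integral => x _; rewrite addrK.
rewrite /density_loss -ge0_integralD//=.
apply: ge0_le_integral => //=; first exact: emeasurable_funD.
move=> x _; have := g1 x; have := g0 x.
case: (g x) => [r| |] //; rewrite !lee_fin => r0 r1.
move: (f k x) (f k (x - t)%R) => a b.
have [h|h] := leP (a - b)%R 0%R.
  by rewrite addr0 ler_wpM2l// -subr_le0.
by rewrite -lerBlDl -mulrBr -[leRHS]mul1r ler_wpM2r// ltW.
Qed.

Lemma probability_translate (t : R) :
  P (joint Y @^-1` A) <=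
  \int[P]_w (\1_A (translate (enum I) t (joint Y w)))%:E +
  \sum_(k <- enum I) density_loss (f k) t.
Proof.
have dl0 k : 0 <= density_loss (f k) t.
  by apply: integral_ge0 => x _; rewrite lee_fin le_max lexx orbT.
suff H s : uniq s -> P (joint Y @^-1` A) <=
    \int[P]_w (\1_A (translate s t (joint Y w)))%:E + \sum_(k <- s) density_loss (f k) t.
  exact/H/enum_uniq.
elim: s => [_|k s ih /= /andP[ks us]].
  rewrite big_nil adde0 -[X in P X]setIT -integral_indic//; last first.
    by rewrite -[X in measurable X]setTI; exact: measurable_joint.
apply: (le_trans (ih us)); rewrite big_cons addeA leeD2r//.
exact: translate_one_more.
Qed.

Hypothesis cf : forall k, continuous (f k).
Hypothesis foo : forall k, \int[mu]_x (f k x)%:E < +oo.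

(** Each line in the diagonal direction meets [A] in a null set, so by Tonelli
    almost every common translation of the samples avoids [A] almost surely.
    Choosing such translations tending to 0, the law of the samples is approached
    in total variation, and the probability of [A] itself is 0. *)
Lemma translation_null :
  (forall y : I -> R, mu [set t | A (fun k => y k + t)%R] = 0) ->
  P (joint Y @^-1` A) = 0.
Proof.
move=> A0.
pose phi t := \int[P]_w (\1_A (translate (enum I) t (joint Y w)))%:E.
have phi0 t : 0 <= phi t by apply: integral_ge0 => w _; rewrite lee_fin.
have mF : measurable_fun [set: R * Omega]
    (fun x => (\1_A (translate (enum I) x.1 (joint Y x.2) : config R I) : R)%:E).
  apply/measurable_EFinP; apply: (measurableT_comp (measurable_indic mA)).
  apply: measurable_config => j; rewrite /translate mem_enum.
  apply: measurable_funD; last exact: measurable_fst.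
  exact: (measurableT_comp (measurable_funP (Y j)) measurable_snd).
have mphi : measurable_fun [set: R] phi.
  by apply: (measurable_fun_fubini_tonelli_F _ mF) => x; rewrite lee_fin.
have intphi : \int[mu]_t phi t = 0.
  transitivity (\int[P]_w \int[mu]_t (\1_A (translate (enum I) t (joint Y w)))%:E).
    by apply: (fubini_tonelli (m1 := mu) (m2 := P) _ mF) => x; rewrite lee_fin.
  rewrite integral0_eq// => w _.
  pose B := [set t | A (fun k => joint Y w k + t)%R].
  have trE t : translate (enum I) t (joint Y w) = (fun k => joint Y w k + t)%R.
    by apply/funext => k; rewrite /translate mem_enum.
  have mB : measurable B.
    rewrite -[X in measurable X]setTI.
    apply: (_ : measurable_fun setT (fun t => (fun k => joint Y w k + t)%R : config R I)) => //.
    by apply: measurable_config => k; exact: measurable_funD.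
  transitivity (\int[mu]_t (\1_B t)%:E); last by rewrite integral_indic// setIT; exact: A0.
  apply: eq_integral => t _; rewrite !indicE trE.
  by rewrite (_ : (_ \in A) = (t \in B)) //; apply: asbool_equiv_eq.
(* A null set cannot contain an interval, so good translations are
   arbitrarily small. *)
have small (e : R) : (0 < e)%R -> exists2 t, (0 < t < e)%R & phi t = 0.
  move=> e0; apply: contrapT => /forall2NP H.
  have /(ae_eq_integral_abs mu measurableT mphi) [N [mN N0 HN]] :
      \int[mu]_t `|phi t| = 0.
    by rewrite -[RHS]intphi; apply: eq_integral => t _; rewrite gee0_abs.
  have : mu `]0%R, e[%classic <= 0.
    rewrite -N0; apply: le_measure; rewrite ?inE//.
    apply: subset_trans HN => t /=; rewrite in_itv/= => te Ht.
    by have [] := H t; [move/negP; rewrite te|apply; rewrite Ht].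
  by rewrite /mu lebesgue_measure_itv/= lte_fin e0 oppr0 adde0 lee_fin leNgt e0.
have /choice[t tP] : forall n : nat, exists t : R, (0 < t < n.+1%:R^-1)%R /\ phi t = 0.
  by move=> n; have [|t] := small n.+1%:R^-1%R; [rewrite invr_gt0|exists t].
have t0 : t n @[n --> \oo] --> (0 : R)%R.
  apply: (@squeeze_cvgr _ _ _ _ (cst 0%R) (fun n => n.+1%:R^-1)%R).
  - by apply: nearW => n; have [/andP[/ltW-> /ltW->]] := tP n.
  - exact: cvg_cst.
  - exact: cvg_harmonic.
apply/eqP; rewrite eq_le measure_ge0 andbT.
have sum0 : \sum_(k <- enum I) density_loss (f k) (t n) @[n --> \oo] --> (0 : \bar R).
  have := @cvg_nnesum nat \oo _ R I (enum I) (fun k n => density_loss (f k) (t n))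
    (fun=> 0) xpredT.
  rewrite big1_eq; apply => k _; last exact: cvg_density_loss.
  by apply: nearW => n; apply: integral_ge0 => x _; rewrite lee_fin le_max lexx orbT.
apply: (cvge_to_ge sum0); apply: nearW => n.
by have := probability_translate (t n); rewrite -/(phi (t n)) (proj2 (tP n)) add0e.
Qed.

End fixed_event.

End translated_samples.

(** * Smoothing a density by the kernel *)

Section smoothing.
Local Open Scope ereal_scope.
Context (R : realType) (K : R -> R).
Hypothesis K_kernel : kernel_assumption K.
Let mu := @lebesgue_measure R.

Let mK := kernel_measurable K_kernel.

Lemma kernel_ge0 t : (0 <= K t)%R.
Proof. by have [CK /(_ t)/andP[]] := kernel_bounded K_kernel. Qed.

Let K0 := kernel_ge0.

Lemma integrable_kernel_moment (g : R -> R) (s : nat) : (s <= 3)%N ->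
  measurable_fun [set: R] g -> (forall t, `|g t| = `|t| ^+ s)%R ->
  mu.-integrable [set: R] (fun t => (g t * K t)%:E).
Proof.
move=> s3 mg gE; apply/integrableP; split.
  by apply/measurable_EFinP; exact: measurable_funM.
have := kernel_moments K_kernel s3; congr (_ < _); apply: eq_integral => t _.
by rewrite /= normrM gE (ger0_norm (K0 t)).
Qed.

Definition scaled (h u : R) : R := (h^-1 * K (u / h))%R.

Lemma scaled_ge0 h u : (0 < h)%R -> (0 <= scaled h u)%R.
Proof. by move=> h0; rewrite mulr_ge0 ?invr_ge0 ?(ltW h0). Qed.

Lemma scaled_le h u CK : (forall t, K t <= CK)%R -> (0 < h)%R -> (scaled h u <= CK / h)%R.
Proof. by move=> KC h0; rewrite /scaled mulrC ler_pM2r ?invr_gt0. Qed.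

Lemma measurable_scaled h : measurable_fun [set: R] (scaled h).
Proof.
by apply: measurable_funM => //; apply: (measurableT_comp mK); exact: measurable_funM.
Qed.

(** Substitution [u = x - h v]. The left-hand side is how the mean of a kernel
    evaluated at a sample appears, the right-hand side is the form in which bias
    and bounds are read off. *)
Lemma integral_scaled (h x : R) (g : R -> R) : (0 < h)%R ->
  measurable_fun [set: R] g -> (forall u, 0 <= g u)%R ->
  \int[mu]_u (scaled h (x - u) * g u)%:E = \int[mu]_v (K v * g (x - h * v))%:E.
Proof.
move=> h0 mg g0.
have mF : measurable_fun [set: R] (fun u => (scaled h (x - u) * g u)%:E).
  apply/measurable_EFinP; apply: measurable_funM => //.
  by apply: (measurableT_comp (measurable_scaled h)); exact: measurable_funB.
have F0 u : 0 <= (scaled h (x - u) * g u)%:E.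
  by rewrite lee_fin mulr_ge0 ?scaled_ge0.
have mG : measurable_fun [set: R] (fun v => (scaled h (x - (- h * v + x)) * g (- h * v + x))%:E).
  apply: (measurableT_comp mF); apply: measurable_funD => //; exact: measurable_funM.
have hn0 : (- h != 0)%R by rewrite oppr_eq0 gt_eqF.
have /(congr1 (mule h%:E)) := ge0_integral_affine x hn0 mF F0.
rewrite muleA -EFinM normrN gtr0_norm// divff ?gt_eqF// mul1e => <-.
rewrite -ge0_integralZl_EFin ?ltW//.
apply: eq_integral => v _; rewrite -EFinM /scaled; congr (_%:E).
rewrite mulrA mulrA divff ?gt_eqF// mul1r; congr (K _ * g _)%R; first by field; rewrite gt_eqF.
by rewrite mulNr addrC.
Qed.

Lemma integral_scaled_r h u : (0 < h)%R -> \int[mu]_x (scaled h (x - u))%:E = 1.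
Proof.
move=> h0; have mEK : measurable_fun [set: R] (EFin \o K) by exact/measurable_EFinP.
have hi : (0 < h^-1)%R by rewrite invr_gt0.
have mA : measurable_fun [set: R] (fun x => (K (h^-1 * x + - u / h))%:E).
  by apply: (measurableT_comp mEK); apply: measurable_funD => //; exact: measurable_funM.
transitivity (\int[mu]_x (h^-1%:E * (K (h^-1 * x + - u / h))%:E)).
  apply: eq_integral => x _; rewrite -EFinM /scaled; congr (_ * K _)%:E.
  by rewrite mulrBl mulrC mulNr.
rewrite ge0_integralZl_EFin ?(ltW hi)//.
rewrite (ge0_integral_pos_affine (- u / h) hi mEK) ?kernel_mass//.
by rewrite mule1 -EFinM invrK mulVf ?gt_eqF.
by move=> x _; rewrite lee_fin.
Qed.

Lemma integrable_kernel : mu.-integrable [set: R] (EFin \o K).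
Proof.
have := @integrable_kernel_moment (cst 1%R) 0 isT (@measurable_cst _ _ _ _ _ _) _.
rewrite /=; under eq_fun do rewrite mul1r; apply => t.
by rewrite normr1 expr0.
Qed.

Lemma Rintegral_kernel : (\int[mu]_t K t)%R = 1%R.
Proof. by rewrite /Rintegral (kernel_mass K_kernel). Qed.

(** The convolution of [f] with [scaled h], after the substitution
    [u = x - h v]. *)
Definition smoothed (h : R) (f : R -> R) (x : R) : R :=
  (\int[mu]_v (K v * f (x - h * v)))%R.

Section bounded_function.
Context (f : R -> R) (B h : R).
Hypotheses (mf : measurable_fun [set: R] f) (f0 : forall x, (0 <= f x)%R).
Hypotheses (fB : forall x, (f x <= B)%R) (h0 : (0 < h)%R).

Let mfh x : measurable_fun [set: R] (fun v => f (x - h * v)).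
Proof.
by apply: (measurableT_comp mf); apply: measurable_funB => //; exact: measurable_funM.
Qed.

Lemma integrable_kernel_mul x :
  mu.-integrable [set: R] (fun v => (K v * f (x - h * v))%:E).
Proof.
have m1 : measurable_fun [set: R] (fun v => K v * f (x - h * v))%R.
  exact: measurable_funM.
apply: (@le_integrable _ _ _ mu _ measurableT _ (fun v => (B%:E * (K v)%:E))).
- exact/measurable_EFinP.
- move=> v _ /=; rewrite lee_fin normrM [leRHS]normrM mulrC ler_wpM2r//.
  by rewrite !ger0_norm// (le_trans (f0 0) (fB 0)).
- by apply: integrableZl => //; exact: integrable_kernel.
Qed.

Lemma smoothedE x :
  (smoothed h f x)%:E = \int[mu]_u (scaled h (x - u) * f u)%:E.
Proof.
rewrite integral_scaled// /smoothed /Rintegral fineK//.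
exact: integrable_fin_num (integrable_kernel_mul x).
Qed.

Lemma smoothed_ge0 x : (0 <= smoothed h f x)%R.
Proof. by apply: Rintegral_ge0 => v _; rewrite mulr_ge0. Qed.

Lemma smoothed_le x : (smoothed h f x <= B)%R.
Proof.
have -> : B = (\int[mu]_v (B * K v))%R.
  by rewrite RintegralZl ?Rintegral_kernel ?mulr1//; exact: integrable_kernel.
apply: le_Rintegral => //; first exact: integrable_kernel_mul.
- by apply: (integrableZl _ _ integrable_kernel).
- by move=> v _; rewrite mulrC ler_wpM2r.
Qed.

Lemma measurable_smoothed : measurable_fun [set: R] (smoothed h f).
Proof.
apply/measurable_EFinP.
have -> : EFin \o smoothed h f = fun x => \int[mu]_u (scaled h (x - u) * f u)%:E.
  by apply/funext => x /=; rewrite smoothedE.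
apply: (measurable_fun_fubini_tonelli_F (m2 := mu)
  (fun x : R * R => (scaled h (x.1 - x.2) * f x.2)%:E)) => [|x]; last first.
  by rewrite lee_fin mulr_ge0 ?scaled_ge0.
apply/measurable_EFinP; apply: measurable_funM.
  apply: (measurableT_comp (measurable_scaled h)).
  by apply: measurable_funB; [exact: measurable_fst|exact: measurable_snd].
exact: (measurableT_comp mf measurable_snd).
Qed.

Lemma integral_smoothed : \int[mu]_x (smoothed h f x)%:E = \int[mu]_x (f x)%:E.
Proof.
under eq_integral do rewrite smoothedE.
pose F (x : R * R) := (scaled h (x.1 - x.2) * f x.2)%:E.
have mF : measurable_fun [set: R * R] F.
  apply/measurable_EFinP; apply: measurable_funM.
    apply: (measurableT_comp (measurable_scaled h)).
    by apply: measurable_funB; [exact: measurable_fst|exact: measurable_snd].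
  exact: (measurableT_comp mf measurable_snd).
have F0 x : 0 <= F x by rewrite lee_fin mulr_ge0 ?scaled_ge0.
rewrite (fubini_tonelli (m1 := mu) (m2 := mu) F mF F0).
have ms u : measurable_fun [set: R] (fun x => (scaled h (x - u))%:E).
  apply/measurable_EFinP; apply: (measurableT_comp (measurable_scaled h)).
  exact: measurable_funB.
apply: eq_integral => u _; rewrite /F /=.
under eq_integral do rewrite EFinM.
rewrite ge0_integralZr// ?lee_fin//; last by move=> x _; rewrite lee_fin scaled_ge0.
by rewrite integral_scaled_r// mul1e.
exact: ms.
Qed.

End bounded_function.

End smoothing.

(** * Bias of the smoothing *)

Section second_order.
Context (R : realType).
Let mu := @lebesgue_measure R.

Lemma mean_value_inequality (f : R -> R) (x v : R) :
  (forall y, derivable f y 1) ->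
  exists2 c, `|c - x| <= `|v| & f (x + v) - f x = derive1 f c * v.
Proof.
move=> df.
have id (y : R) : is_derive y 1 f (derive1 f y).
  by rewrite derive1E; exact: derivableP.
have cf a b : {within `[a, b], continuous f}.
  by apply: derivable_within_continuous => y _; exact: df.
have [v0|v0] := leP 0 v.
  have xv : x <= x + v by rewrite lerDl.
  have [c] := MVT_segment xv (fun y _ => id y) (cf _ _).
  rewrite in_itv/= => /andP[xc cx] E; exists c; last by rewrite E; congr (_ * _); ring.
  by rewrite !ger0_norm ?subr_ge0// lerBlDl.
have xv : x + v <= x by rewrite gerDl ltW.
have [c] := MVT_segment xv (fun y _ => id y) (cf _ _).
rewrite in_itv/= => /andP[xc cx] E; exists c.
  by rewrite (ltr0_norm v0) ler0_norm ?subr_le0//; lra.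
by rewrite -opprB E; ring.
Qed.

(** The mean value theorem applied to [f] and then to its derivative, whence the
    constant [B] instead of [B / 2]. *)
Lemma second_order_bound (f : R -> R) (B : R) (x v : R) :
  (forall y, derivable f y 1) -> (forall y, derivable (derive1 f) y 1) ->
  (forall y, `|derive1 (derive1 f) y| <= B) ->
  `|f (x + v) - f x - v * derive1 f x| <= B * v ^+ 2.
Proof.
move=> df ddf fB.
have [c cx ->] := mean_value_inequality x v df.
have [e _ E] := mean_value_inequality x (c - x) ddf.
rewrite mulrC -mulrBr; move: E; rewrite addrCA subrr addr0 => ->.
rewrite !normrM mulrCA; apply: ler_pM => //.
by rewrite -(real_normK (num_real v)) expr2 ler_wpM2l.
Qed.

End second_order.

Section bias.
Context (R : realType) (K : R -> R).
Hypothesis K_kernel : kernel_assumption K.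
Let mu := @lebesgue_measure R.

(** Since [K] has mass 1 and mean 0, the difference is the integral of [K]
    against the second order remainder of [f] at [x]. *)
Lemma smoothed_bias (f : R -> R) (B B2 h x : R) :
  measurable_fun [set: R] f -> (forall x, 0 <= f x) -> (forall x, f x <= B) ->
  (forall y, derivable f y 1) -> (forall y, derivable (derive1 f) y 1) ->
  (forall y, `|derive1 (derive1 f) y| <= B2) -> 0 < h ->
  `|smoothed K h f x - f x| <= B2 * h ^+ 2 * \int[mu]_t (t ^+ 2 * K t).
Proof.
move=> mf f0 fB df ddf f2B h0.
have K0 := kernel_ge0 K_kernel.
have i0 := integrable_kernel K_kernel.
have i1 : mu.-integrable [set: R] (fun t => (t * K t)%:E).
  exact: (@integrable_kernel_moment _ _ K_kernel id 1).
have i2 : mu.-integrable [set: R] (fun t => (t ^+ 2 * K t)%:E).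
  apply: (@integrable_kernel_moment _ _ K_kernel (fun t => t ^+ 2) 2) => //.
  by move=> t; rewrite normrX.
have iK := integrable_kernel_mul K_kernel h mf f0 fB x.
have iB : mu.-integrable [set: R] (fun v => (f x * K v)%:E).
  exact: (integrableZl _ _ i0).
have iC : mu.-integrable [set: R] (fun v => (h * derive1 f x * (v * K v))%:E).
  exact: (integrableZl _ _ i1).
have iBC : mu.-integrable [set: R] (fun v => (f x * K v - h * derive1 f x * (v * K v))%:E).
  exact: (integrableB _ iB iC).
have iD : mu.-integrable [set: R]
    (fun v => (K v * f (x - h * v) - (f x * K v - h * derive1 f x * (v * K v)))%:E).
  exact: (integrableB _ iK iBC).
have -> : f x = \int[mu]_v (f x * K v - h * derive1 f x * (v * K v)).
  rewrite RintegralB// !RintegralZl// (Rintegral_kernel K_kernel) mulr1.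
  by rewrite /Rintegral (kernel_centered K_kernel) mulr0 subr0.
rewrite /smoothed -RintegralB//.
apply: (le_trans (le_normr_Rintegral _ iD)) => //.
rewrite -RintegralZl//.
apply: le_Rintegral => //.
- exact: integrable_norm iD.
- exact: (integrableZl _ _ i2).
move=> v _ /=.
have -> : K v * f (x - h * v) - (f x * K v - h * derive1 f x * (v * K v)) =
    (f (x + - (h * v)) - f x - (- (h * v)) * derive1 f x) * K v by ring.
rewrite normrM (ger0_norm (K0 v)).
have := second_order_bound x (- (h * v)) df ddf f2B.
move=> /(ler_wpM2r (K0 v)) /le_trans; apply.
by rewrite sqrrN exprMn !mulrA.
Qed.

End bias.

(** * Correlation of the kernel at two points *)

Section overlap.
Local Open Scope ereal_scope.
Context (R : realType) (K : R -> R).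
Hypothesis K_kernel : kernel_assumption K.
Let mu := @lebesgue_measure R.
Context (f : R -> R) (B CK h : R).
Hypotheses (mf : measurable_fun [set: R] f) (f0 : forall x, (0 <= f x)%R).
Hypotheses (fB : forall x, (f x <= B)%R) (KC : forall t, (K t <= CK)%R).
Hypothesis h0 : (0 < h)%R.

Let s0 u : (0 <= scaled K h u)%R. Proof. exact: scaled_ge0. Qed.

(** The mean of [scaled h (x - U) * scaled h (y - U)] for [U] of density [f]: the
    diagonal contribution to the second moment of a kernel density estimate. *)
Definition overlap (x y : R) : R :=
  (\int[mu]_u (scaled K h (x - u) * scaled K h (y - u) * f u))%R.

Let overlap_int (z : R * R) (u : R) : R :=
  (scaled K h (z.1 - u) * scaled K h (z.2 - u) * f u)%R.

Let overlap_int_ge0 z u : (0 <= overlap_int z u)%R.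
Proof. by apply: mulr_ge0; [exact: mulr_ge0|exact: f0]. Qed.

Let measurable_overlap_int :
  measurable_fun [set: R * R * R] (fun z => overlap_int z.1 z.2).
Proof.
have ms := measurable_scaled K_kernel h.
have m2 : measurable_fun [set: R * R * R] (fun z => z.2) by exact: measurable_snd.
have m11 : measurable_fun [set: R * R * R] (fun z => z.1.1).
  exact: (measurableT_comp measurable_fst measurable_fst).
have m12 : measurable_fun [set: R * R * R] (fun z => z.1.2).
  exact: (measurableT_comp measurable_snd measurable_fst).
apply: measurable_funM; last exact: (measurableT_comp mf m2).
by apply: measurable_funM; apply: (measurableT_comp ms); exact: measurable_funB.
Qed.

Let measurable_overlap_int2 z : measurable_fun [set: R] (overlap_int z).
Proof. exact: (measurable_fun_pair2 z measurable_overlap_int). Qed.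

Let overlap_int_le z u : (overlap_int z u <= CK / h * (scaled K h (z.2 - u) * f u))%R.
Proof.
rewrite /overlap_int -mulrA; apply: ler_wpM2r; first exact: mulr_ge0.
exact: (scaled_le (K := K)).
Qed.

Let int_overlap_le z :
  \int[mu]_u (overlap_int z u)%:E <= (CK / h * B)%:E.
Proof.
have m1 : measurable_fun [set: R] (fun u => (scaled K h (z.2 - u) * f u)%:E).
  apply/measurable_EFinP; apply: measurable_funM => //.
  by apply: (measurableT_comp (measurable_scaled K_kernel h)); exact: measurable_funB.
have mo : measurable_fun [set: R] (fun u => (overlap_int z u)%:E).
  exact/measurable_EFinP.
have mc : measurable_fun [set: R] (fun u => (CK / h)%:E * (scaled K h (z.2 - u) * f u)%:E).
  exact: emeasurable_funM.
have CK0 : (0 <= CK / h)%R.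
  by apply: divr_ge0; [exact: le_trans (kernel_ge0 K_kernel 0%R) (KC 0%R)|exact: ltW].
apply: (@le_trans _ _ (\int[mu]_u ((CK / h)%:E * (scaled K h (z.2 - u) * f u)%:E))).
  apply: ge0_le_integral => //.
  - by move=> u _; rewrite lee_fin.
  - by move=> u _; rewrite -EFinM lee_fin.
rewrite ge0_integralZl_EFin//; last by move=> u _; rewrite lee_fin mulr_ge0.
rewrite -(smoothedE K_kernel mf f0 fB h0) -EFinM lee_fin ler_wpM2l//.
exact: smoothed_le.
Qed.

Lemma overlapE x y : (overlap x y)%:E =
  \int[mu]_u (scaled K h (x - u) * scaled K h (y - u) * f u)%:E.
Proof.
rewrite /overlap /Rintegral fineK// ge0_fin_numE.
  exact: le_lt_trans (int_overlap_le (x, y)) (ltry _).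
by apply: integral_ge0 => u _; rewrite lee_fin (overlap_int_ge0 (x, y)).
Qed.

Lemma overlap_ge0 x y : (0 <= overlap x y)%R.
Proof. by apply: Rintegral_ge0 => u _; exact: (overlap_int_ge0 (x, y)). Qed.

Lemma overlap_le x y : (overlap x y <= CK / h * B)%R.
Proof. by rewrite -lee_fin overlapE; exact: (int_overlap_le (x, y)). Qed.

Lemma measurable_overlap : measurable_fun [set: R * R] (fun z => overlap z.1 z.2).
Proof.
apply/measurable_EFinP.
have -> : EFin \o (fun z => overlap z.1 z.2) =
    fun z => \int[mu]_u (overlap_int z u)%:E.
  by apply/funext => z /=; rewrite overlapE.
apply: (measurable_fun_fubini_tonelli_F (m2 := mu)
  (fun x : R * R * R => (overlap_int x.1 x.2)%:E)) => [|x]; last by rewrite lee_fin.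
exact/measurable_EFinP.
Qed.

(** Integrating in [y] first removes one kernel, as each kernel has mass 1. *)
Lemma integral_overlap :
  \int[mu]_x \int[mu]_y (overlap x y)%:E = \int[mu]_x (f x)%:E.
Proof.
rewrite -(integral_smoothed K_kernel mf f0 fB h0); apply: eq_integral => x _.
under eq_integral do rewrite overlapE.
rewrite (fubini_tonelli (m1 := mu) (m2 := mu)
  (fun z : R * R => (overlap_int (x, z.1) z.2)%:E)); last 2 first.
- have mp : measurable_fun [set: R * R] (fun z : R * R => ((x, z.1), z.2)).
    apply: measurable_fun_pair; last exact: measurable_snd.
    by apply: measurable_fun_pair; [exact: measurable_cst|exact: measurable_fst].
  by apply/measurable_EFinP; exact: (measurableT_comp measurable_overlap_int mp).
- by move=> z; rewrite lee_fin.
rewrite (smoothedE K_kernel mf f0 fB h0); apply: eq_integral => u _.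
have ms : measurable_fun [set: R] (fun y => (scaled K h (y - u))%:E).
  apply/measurable_EFinP; apply: (measurableT_comp (measurable_scaled K_kernel h)).
  exact: measurable_funB.
rewrite -[RHS]mul1e -(integral_scaled_r K_kernel u h0) -ge0_integralZr//.
- apply: eq_integral => y _; rewrite -EFinM /overlap_int /=; congr (_%:E); ring.
- by move=> y _; rewrite lee_fin.
- by rewrite lee_fin mulr_ge0.
Qed.

End overlap.

(** * The kernel density estimate *)

Section kde_facts.
Context (R : realType) (K : R -> R).
Hypothesis K_kernel : kernel_assumption K.
Let mu := @lebesgue_measure R.

Lemma kdeE (n : nat) (h : R) (xs : 'I_n -> R) x :
  kde K h xs x = n%:R^-1 * \sum_(i < n) scaled K h (x - xs i).
Proof. by rewrite /kde invfM -mulrA; congr (_ * _); rewrite mulr_sumr. Qed.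

Lemma kde_ge0 n h (xs : 'I_n -> R) x : 0 < h -> 0 <= kde K h xs x.
Proof.
move=> h0; rewrite kdeE mulr_ge0 ?invr_ge0//.
by apply: sumr_ge0 => i _; exact: scaled_ge0.
Qed.

Lemma kde_le n h (xs : 'I_n -> R) x CK : (forall t, K t <= CK) -> 0 < h ->
  kde K h xs x <= CK / h.
Proof.
move=> KC h0; have C0 : 0 <= CK / h.
  by apply: divr_ge0; [exact: le_trans (kernel_ge0 K_kernel 0) (KC 0)|exact: ltW].
rewrite kdeE; case: n xs => [xs|n xs]; first by rewrite big_ord0 mulr0.
rewrite ler_pdivrMl ?ltr0n//.
rewrite -[leRHS](_ : \sum_(i < n.+1) CK / h = _); last by rewrite sumr_const card_ord mulr_natl.
by apply: ler_sum => i _; exact: scaled_le.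
Qed.

Lemma measurable_kde_data d (T : measurableType d) n h (xs : T -> 'I_n -> R) (x : T -> R) :
  measurable_fun [set: T] x -> (forall i, measurable_fun [set: T] (xs ^~ i)) ->
  measurable_fun [set: T] (fun t => kde K h (xs t) (x t)).
Proof.
move=> mx mxs; rewrite (_ : (fun t => _) = fun t => n%:R^-1 * \sum_(i < n) scaled K h (x t - xs t
    i)).
  apply: measurable_funM => //; apply: measurable_sum => i.
  by apply: (measurableT_comp (measurable_scaled K_kernel h)); exact: measurable_funB.
by apply/funext => t; rewrite kdeE.
Qed.

Lemma integral_kde n h (xs : 'I_n -> R) : (0 < n)%N -> 0 < h ->
  (\int[mu]_x (kde K h xs x)%:E = 1)%E.
Proof.
move=> n0 h0.
have ms i : measurable_fun [set: R] (fun x => (scaled K h (x - xs i))%:E).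
  apply/measurable_EFinP; apply: (measurableT_comp (measurable_scaled K_kernel h)).
  exact: measurable_funB.
have s0 u : 0 <= scaled K h u by exact: scaled_ge0.
have s0' i x : (0 <= (scaled K h (x - xs i))%:E)%E by rewrite lee_fin.
have mS : measurable_fun [set: R] (fun x => (\sum_(i < n) (scaled K h (x - xs i))%:E)%E).
  exact: emeasurable_sum.
transitivity ((n%:R^-1)%:E * \int[mu]_x (\sum_(i < n) (scaled K h (x - xs i))%:E))%E.
  rewrite -ge0_integralZl_EFin ?invr_ge0//; last by move=> x _; exact: sume_ge0.
  by apply: eq_integral => x _; rewrite kdeE EFinM -sumEFin.
have -> : (\int[mu]_x (\sum_(i < n) (scaled K h (x - xs i))%:E) = \sum_(i < n) 1)%E.
  rewrite (ge0_integral_sum mu measurableT ms (fun i x _ => s0' i x)).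
  by apply: eq_bigr => i _; exact: integral_scaled_r.
by rewrite sumEFin sumr_const card_ord -EFinM mulVf// pnatr_eq0 -lt0n.
Qed.

End kde_facts.

(** * Moments of the product of the estimates *)

Section estimator_moments.
Context d (Omega : measurableType d) (R : realType) (P : probability Omega R).
Context (K : R -> R) (M : nat) (N : 'I_M -> nat) (h : 'I_M -> R) (p : 'I_M -> R -> R).
Context (X : forall m, 'I_(N m) -> {RV P >-> R}) (B CK : R).
Hypothesis K_kernel : kernel_assumption K.
Hypothesis X_sample : sample_assumption p X.
Hypotheses (N0 : forall m, (0 < N m)%N) (h0 : forall m, 0 < h m).
Hypotheses (mp : forall m, measurable_fun [set: R] (p m)) (p0 : forall m x, 0 <= p m x).
Hypotheses (pB : forall m x, p m x <= B) (KC : forall t, K t <= CK).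
Let mu := @lebesgue_measure R.

Local Notation index := {m : 'I_M & 'I_(N m)}.
Let Y (k : index) : {RV P >-> R} := @X (tag k) (tagged k).

Definition data (y : index -> R) (m : 'I_M) (i : 'I_(N m)) : R :=
  y (Tagged (fun m => 'I_(N m)) i).

Let kdem m (y : config R index) x := kde K (h m) (data y (m := m)) x.

Let mkde m : measurable_fun [set: R * config R index] (fun z => kdem m z.2 z.1).
Proof.
apply: (@measurable_kde_data _ _ K_kernel _ (R * config R index)%type _ (h m)
  (fun z i => data z.2 i) fst); first exact: measurable_fst.
move=> i; exact: (measurableT_comp (measurable_coord (Tagged (fun m => 'I_(N m)) i))
    measurable_snd).
Qed.

Local Open Scope ereal_scope.

Lemma expectation_scaled m (i : 'I_(N m)) x :
  \int[P]_w (scaled K (h m) (x - X i w))%:E = (smoothed K (h m) (p m) x)%:E.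
Proof.
have ms : measurable_fun [set: R] (fun u => (scaled K (h m) (x - u))%:E).
  apply/measurable_EFinP; apply: (measurableT_comp (measurable_scaled K_kernel (h m))).
  exact: measurable_funB.
rewrite (expectation_density (@mp m) (@p0 m) (X_sample.1 m i) ms); last first.
  by move=> u; rewrite lee_fin scaled_ge0.
by rewrite (smoothedE K_kernel (@mp m) (@p0 m) (@pB m) (h0 m)).
Qed.

Lemma expectation_scaled_mul m (i j : 'I_(N m)) x y :
  \int[P]_w (scaled K (h m) (x - X i w) * scaled K (h m) (y - X j w))%:E =
  if i == j then (overlap K (p m) (h m) x y)%:E
  else (smoothed K (h m) (p m) x * smoothed K (h m) (p m) y)%:E.
Proof.
have ms z : measurable_fun [set: R] (fun u => (scaled K (h m) (z - u))%:E).
  apply/measurable_EFinP; apply: (measurableT_comp (measurable_scaled K_kernel (h m))).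
  exact: measurable_funB.
have s0 u : (0 <= scaled K (h m) u)%R by exact: scaled_ge0.
case: eqP => [<-|ij].
  have ms2 : measurable_fun [set: R]
      (fun u => (scaled K (h m) (x - u) * scaled K (h m) (y - u))%:E).
    by under eq_fun do rewrite EFinM; exact: emeasurable_funM.
  rewrite (expectation_density (@mp m) (@p0 m) (X_sample.1 m i) ms2); last first.
    by move=> u; rewrite lee_fin mulr_ge0.
  by rewrite (overlapE K_kernel (@mp m) (@p0 m) (@pB m) KC (h0 m)).
pose c (i : 'I_(N m)) : index := Tagged (fun m => 'I_(N m)) i.
pose F z i (v : config R index) := (scaled K (h m) (z - v (c i)))%:E.
have mF z k : measurable_fun [set: config R index] (F z k).
  exact: (measurableT_comp (ms z) (measurable_coord (c k))).
rewrite EFinM -(expectation_scaled i) -(expectation_scaled j).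
apply: (expectation_mul_blocks X_sample.2 (B := pred1 (c i)) (F := F x i) (G := F y j)) => //.
- by move=> v; rewrite lee_fin.
- by move=> v; rewrite lee_fin.
- by move=> v v' vv; rewrite /F vv//=.
move=> v v' vv; rewrite /F vv//=; apply/eqP => cji; apply: ij.
by have /eqP := cji; rewrite -tag_eqE /tag_eq eqxx/= tagged_asE => /eqP.
Qed.

Let meanE (m : 'I_M) x : R := smoothed K (h m) (p m) x.

Lemma expectation_kde m x :
  \int[P]_w (kdem m (joint Y w) x)%:E = (meanE m x)%:E.
Proof.
have s0 (i : 'I_(N m)) w : 0 <= (scaled K (h m) (x - X i w))%:E.
  by rewrite lee_fin scaled_ge0.
have ms (i : 'I_(N m)) : measurable_fun [set: Omega] (fun w => (scaled K (h m) (x - X i w))%:E).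
  apply/measurable_EFinP; apply: (measurableT_comp (measurable_scaled K_kernel (h m))).
  by apply: measurable_funB => //; exact: measurable_funP.
transitivity (((N m)%:R^-1)%:E * \int[P]_w (\sum_(i < N m) (scaled K (h m) (x - X i w))%:E)).
  rewrite -ge0_integralZl_EFin ?invr_ge0//; last 2 first.
  - by move=> w _; exact: sume_ge0.
  - exact: emeasurable_sum.
  by apply: eq_integral => w _; rewrite /kdem kdeE EFinM -sumEFin.
rewrite (ge0_integral_sum P measurableT ms (fun i w _ => s0 i w)).
under eq_bigr do rewrite expectation_scaled.
rewrite sumEFin sumr_const card_ord -EFinM -[(smoothed _ _ _ _ *+ _)%R]mulr_natl mulrA mulVf
    ?mul1r//.
by rewrite pnatr_eq0 -lt0n.
Qed.

Let second (m : 'I_M) x y : R :=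
  (meanE m x * meanE m y + (N m)%:R^-1 * overlap K (p m) (h m) x y)%R.

(** Distinct samples are independent and contribute the product of the means;
    only the [N m] diagonal pairs, out of [N m ^ 2], contribute an overlap. *)
Lemma expectation_kde_mul m x y :
  \int[P]_w (kdem m (joint Y w) x * kdem m (joint Y w) y)%:E <= (second m x y)%:E.
Proof.
pose q := overlap K (p m) (h m) x y.
have q0 : (0 <= q)%R by exact: (overlap_ge0 K_kernel).
pose a (i j : 'I_(N m)) w := (scaled K (h m) (x - X i w) * scaled K (h m) (y - X j w))%:E.
have a0 i j w : 0 <= a i j w by rewrite lee_fin mulr_ge0// scaled_ge0.
have ms z (i : 'I_(N m)) : measurable_fun [set: Omega] (fun w => scaled K (h m) (z - X i w)).
  apply: (measurableT_comp (measurable_scaled K_kernel (h m))).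
  by apply: measurable_funB => //; exact: measurable_funP.
have ma i j : measurable_fun [set: Omega] (a i j).
  by apply/measurable_EFinP; exact: measurable_funM.
have ma' i : measurable_fun [set: Omega] (fun w => \sum_(j < N m) a i j w).
  exact: emeasurable_sum.
have a0' i w : 0 <= \sum_(j < N m) a i j w by exact: sume_ge0.
have -> : \int[P]_w (kdem m (joint Y w) x * kdem m (joint Y w) y)%:E =
    ((N m)%:R^-1 ^+ 2)%:E * \int[P]_w (\sum_(i < N m) \sum_(j < N m) a i j w).
  rewrite -ge0_integralZl_EFin ?sqr_ge0//; last 2 first.
  - by move=> w _; exact: sume_ge0.
  - exact: emeasurable_sum.
  apply: eq_integral => w _; rewrite /kdem !kdeE.
  have -> : \sum_(i < N m) \sum_(j < N m) a i j w =
      ((\sum_(i < N m) scaled K (h m) (x - X i w)) *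
       (\sum_(j < N m) scaled K (h m) (y - X j w)))%:E.
    rewrite mulr_suml -sumEFin; apply: eq_bigr => i _.
    by rewrite mulr_sumr -sumEFin.
  by rewrite -EFinM mulrACA expr2.
rewrite (ge0_integral_sum P measurableT ma' (fun i w _ => a0' i w)).
apply: (@le_trans _ _ (((N m)%:R^-1 ^+ 2)%:E *
    \sum_(i < N m) \sum_(j < N m) (meanE m x * meanE m y + (i == j)%:R * q)%:E)).
  apply: lee_wpmul2l; first by rewrite lee_fin sqr_ge0.
  apply: lee_sum => i _; rewrite (ge0_integral_sum P measurableT (ma i) (fun j w _ => a0 i j w)).
  apply: lee_sum => j _; rewrite /a expectation_scaled_mul; case: (i == j).
    by rewrite mul1r lee_fin lerDr mulr_ge0//; exact: (smoothed_ge0 K_kernel).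
  by rewrite mul0r addr0.
under eq_bigr do rewrite sumEFin; rewrite sumEFin -EFinM lee_fin.
under eq_bigr => i _.
  rewrite big_split/= sumr_const card_ord -mulr_suml (bigD1 i)//= eqxx big1 ?addr0 ?mul1r.
  over.
  by move=> j; rewrite eq_sym => /negbTE ->.
rewrite big_split/= !sumr_const card_ord /second -/q expr2.
have Nn : (N m)%:R != 0%R :> R by rewrite pnatr_eq0 -lt0n.
rewrite le_eqVlt; apply/orP; left; apply/eqP; field; exact: Nn.
Qed.

(** The product estimator as a function of the configuration of all samples,
    so that samples can be spliced, updated and translated. *)
Definition product_kde (v : index -> R) : R -> R :=
  pointwise_prod (fun m => kde K (h m) (data v (m := m))).

Let kdem_ge0 m v x : (0 <= kdem m v x)%R. Proof. exact: kde_ge0. Qed.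

Lemma product_kde_ge0 v x : (0 <= product_kde v x)%R.
Proof. by apply: prodr_ge0 => m _; exact: kde_ge0. Qed.

Lemma measurable_product_kde :
  measurable_fun [set: R * config R index] (fun z => product_kde z.2 z.1).
Proof. by apply: measurable_prod => m _; exact: mkde. Qed.

Lemma measurable_product_kde_at v : measurable_fun [set: R] (product_kde v).
Proof. exact: (measurable_fun_pair1 (v : config R index) measurable_product_kde). Qed.

Let kdem_depends m x : depends_on [pred k : index | tag k == m]
  (fun v => (kdem m v x)%:E).
Proof.
move=> v v' vv; rewrite /kdem /kde; congr (_ * _)%:E; apply: eq_bigr => i _.
by congr (K ((x - _) / _))%R; rewrite /data vv//=.
Qed.

Let mkdem m x : measurable_fun [set: config R index] (fun v => kdem m v x).
Proof. exact: (measurable_fun_pair2 x (mkde m)). Qed.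

Lemma expectation_product_kde x :
  \int[P]_w (product_kde (joint Y w) x)%:E = (\prod_m meanE m x)%:E.
Proof.
rewrite -prodEFin; under eq_integral do rewrite -prodEFin.
have := expectation_prod_blocks X_sample.2 (b := @tag _ _) (F := fun m v => (kdem m v x)%:E).
move=> ->.
- by apply: eq_bigr => m _; exact: expectation_kde.
- by move=> m; apply/measurable_EFinP; exact: mkdem.
- by move=> m v; rewrite lee_fin.
- by move=> m; exact: kdem_depends.
Qed.

Lemma expectation_product_kde_mul x y :
  \int[P]_w (product_kde (joint Y w) x * product_kde (joint Y w) y)%:E <=
  (\prod_m second m x y)%:E.
Proof.
have -> : \int[P]_w (product_kde (joint Y w) x * product_kde (joint Y w) y)%:E =
    \int[P]_w \prod_m (kdem m (joint Y w) x * kdem m (joint Y w) y)%:E.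
  by apply: eq_integral => w _; rewrite prodEFin big_split.
have -> := expectation_prod_blocks X_sample.2 (b := @tag _ _)
  (F := fun m v => (kdem m v x * kdem m v y)%:E).
- have I0 m : 0 <= \int[P]_w (kdem m (joint Y w) x * kdem m (joint Y w) y)%:E.
    by apply: integral_ge0 => w _; rewrite lee_fin mulr_ge0.
  rewrite -prodEFin; elim: (index_enum _) => [|m s ih]; first by rewrite !big_nil.
  rewrite !big_cons; apply: lee_pmul => //; last exact: expectation_kde_mul.
  exact: prode_ge0.
- by move=> m; apply/measurable_EFinP; apply: measurable_funM; exact: mkdem.
- by move=> m v; rewrite lee_fin mulr_ge0.
- move=> m v v' vv; rewrite !EFinM.
  by congr (_ * _); [exact: (kdem_depends (m := m) x vv)|exact: (kdem_depends (m := m) y vv)].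
Qed.

(** Bounding all factors but one keeps an integrable majorant. *)
Lemma product_kde_le (m0 : 'I_M) v x :
  (product_kde v x <= \prod_(m < M | m != m0) (CK / h m) * kdem m0 v x)%R.
Proof.
rewrite /product_kde /pointwise_prod (bigD1 m0)//= mulrC; apply: ler_wpM2r.
  exact: kde_ge0.
apply: ler_prod => m _; apply/andP; split; [exact: kde_ge0|exact: kde_le].
Qed.

Lemma integral_product_kde_le (m0 : 'I_M) v :
  \int[mu]_x (product_kde v x)%:E <= (\prod_(m < M | m != m0) (CK / h m))%:E.
Proof.
set c := (\prod_(m < M | m != m0) (CK / h m))%R.
have CK0 : (0 <= CK)%R by exact: le_trans (kernel_ge0 K_kernel 0%R) (KC 0%R).
have c0 : (0 <= c)%R by apply: prodr_ge0 => m _; rewrite divr_ge0// ltW.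
have m1 : measurable_fun [set: R] (fun x => (product_kde v x)%:E).
  by apply/measurable_EFinP; exact: measurable_product_kde_at.
have m2 : measurable_fun [set: R] (fun x => (kdem m0 v x)%:E).
  by apply/measurable_EFinP; exact: (measurable_fun_pair1 (v : config R index) (mkde m0)).
have m3 : measurable_fun [set: R] (fun x => c%:E * (kdem m0 v x)%:E).
  exact: emeasurable_funM.
have e0 x : 0 <= (product_kde v x)%:E by rewrite lee_fin product_kde_ge0.
apply: (@le_trans _ _ (\int[mu]_x (c%:E * (kdem m0 v x)%:E))).
  apply: ge0_le_integral => // x _; rewrite -EFinM lee_fin; exact: product_kde_le.
rewrite ge0_integralZl_EFin//; last by move=> x _; rewrite lee_fin.
by rewrite integral_kde// mule1.
Qed.

Lemma mass_product_kdeE (m0 : 'I_M) v :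
  (mass (product_kde v))%:E = \int[mu]_x (product_kde v x)%:E.
Proof.
rewrite /mass /Rintegral fineK// ge0_fin_numE.
  exact: le_lt_trans (integral_product_kde_le m0 v) (ltry _).
by apply: integral_ge0 => x _; rewrite lee_fin product_kde_ge0.
Qed.

Lemma mass_product_kde_ge0 v : (0 <= mass (product_kde v))%R.
Proof. by apply: Rintegral_ge0 => x _; exact: product_kde_ge0. Qed.

Lemma measurable_mass_product_kde (m0 : 'I_M) :
  measurable_fun [set: config R index] (fun v => mass (product_kde v)).
Proof.
apply/measurable_EFinP.
have -> : EFin \o (fun v => mass (product_kde v)) =
    (fun v => \int[mu]_x (product_kde v x)%:E).
  by apply/funext => v /=; rewrite (mass_product_kdeE m0).
apply: (measurable_fun_fubini_tonelli_G (m1 := mu)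
  (fun z : R * config R index => (product_kde z.2 z.1)%:E)) => [|z].
  by apply/measurable_EFinP; exact: measurable_product_kde.
by rewrite lee_fin product_kde_ge0.
Qed.

Let mjoint : measurable_fun [set: R * Omega] (fun z => (z.1, joint Y z.2 : config R index)).
Proof.
apply: measurable_fun_pair; first exact: measurable_fst.
exact: (measurableT_comp (measurable_joint Y) measurable_snd).
Qed.

Lemma expectation_mass (m0 : 'I_M) :
  \int[P]_w (mass (product_kde (joint Y w)))%:E = \int[mu]_x (\prod_m meanE m x)%:E.
Proof.
under eq_integral do rewrite (mass_product_kdeE m0).
have mF : measurable_fun [set: R * Omega] (fun z => (product_kde (joint Y z.2) z.1)%:E).
  by apply/measurable_EFinP; exact: (measurableT_comp measurable_product_kde mjoint).
have F0 (z : R * Omega) : 0 <= (product_kde (joint Y z.2) z.1)%:E.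
  by rewrite lee_fin product_kde_ge0.
have <- := fubini_tonelli (m1 := mu) (m2 := P) _ mF F0.
by apply: eq_integral => x _; rewrite /= expectation_product_kde.
Qed.

(** The square of the mass is the double integral of the product of the
    estimates at two points; Tonelli brings the expectation inside. *)
Lemma expectation_mass_sqr (m0 : 'I_M) :
  \int[P]_w ((mass (product_kde (joint Y w))) ^+ 2)%:E <=
  \int[mu]_x \int[mu]_y (\prod_m second m x y)%:E.
Proof.
have pk0 v x : 0 <= (product_kde v x)%:E by rewrite lee_fin product_kde_ge0.
have mpk v : measurable_fun [set: R] (fun x => (product_kde v x)%:E).
  by apply/measurable_EFinP; exact: measurable_product_kde_at.
have pkm0 v x y : 0 <= (product_kde v x * product_kde v y)%:E.
  by rewrite lee_fin mulr_ge0// product_kde_ge0.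
have mprod : measurable_fun [set: R * (R * Omega)]
    (fun z => (product_kde (joint Y z.2.2) z.1 * product_kde (joint Y z.2.2) z.2.1)%:E).
  have mw : measurable_fun [set: R * (R * Omega)] (fun z => joint Y z.2.2 : config R index).
    apply: (measurableT_comp (measurable_joint Y)).
    exact: (measurableT_comp measurable_snd measurable_snd).
  apply/measurable_EFinP; apply: measurable_funM.
    apply: (measurableT_comp measurable_product_kde (_ : measurable_fun _ (fun z : R * (R *
        Omega) => (z.1, joint Y z.2.2 : config R index)))).
    by apply: measurable_fun_pair; first exact: measurable_fst.
  apply: (measurableT_comp measurable_product_kde (_ : measurable_fun _ (fun z : R * (R * Omega)
      => (z.2.1, joint Y z.2.2 : config R index)))).
  by apply: measurable_fun_pair => //; exact: (measurableT_comp measurable_fst measurable_snd).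
have sqE w : ((mass (product_kde (joint Y w))) ^+ 2)%:E =
    \int[mu]_x \int[mu]_y (product_kde (joint Y w) x * product_kde (joint Y w) y)%:E.
  set v := joint Y w.
  rewrite expr2 EFinM {1}(mass_product_kdeE m0) -ge0_integralZr//; last 2 first.
  - exact: mpk.
  - by rewrite lee_fin mass_product_kde_ge0.
  apply: eq_integral => x _; rewrite (mass_product_kdeE m0) -ge0_integralZl//.
  exact: mpk.
under eq_integral do rewrite sqE.
pose G (z : R * Omega) := \int[mu]_y (product_kde (joint Y z.2) z.1 * product_kde (joint Y z.2)
    y)%:E.
have mG : measurable_fun [set: R * Omega] G.
  apply: (measurable_fun_fubini_tonelli_F (m2 := mu) (fun z : R * Omega * R =>
    (product_kde (joint Y z.1.2) z.1.1 * product_kde (joint Y z.1.2) z.2)%:E)) => [|z]; last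
        exact: pkm0.
  have mz : measurable_fun [set: R * Omega * R] (fun z => (z.1.1, (z.2, z.1.2))).
    apply: measurable_fun_pair; first exact: (measurableT_comp measurable_fst measurable_fst).
    by apply: measurable_fun_pair; [exact: measurable_snd|exact: (measurableT_comp measurable_snd
        measurable_fst)].
  exact: (measurableT_comp mprod mz).
have G0 z : 0 <= G z by apply: integral_ge0 => y _; exact: pkm0.
rewrite -[leLHS](fubini_tonelli (m1 := mu) (m2 := P) G mG G0).
pose S (z : R * R) := (\prod_m second m z.1 z.2)%:E.
have meanE0 m x : (0 <= meanE m x)%R by exact: (smoothed_ge0 K_kernel).
have S0 z : 0 <= S z.
  rewrite lee_fin; apply: prodr_ge0 => m _; rewrite addr_ge0 ?mulr_ge0 ?invr_ge0//.
  exact: (overlap_ge0 K_kernel).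
have mS : measurable_fun [set: R * R] S.
  have mmean m : measurable_fun [set: R] (meanE m).
    exact: (measurable_smoothed K_kernel (@mp m) (@p0 m) (@pB m) (h0 m)).
  apply/measurable_EFinP; apply: measurable_prod => m _; apply: measurable_funD.
    apply: measurable_funM; first exact: (measurableT_comp (mmean m) measurable_fst).
    exact: (measurableT_comp (mmean m) measurable_snd).
  apply: measurable_funM => //.
  exact: (measurable_overlap K_kernel (@mp m) (@p0 m) (@pB m) KC (h0 m)).
have mPG : measurable_fun [set: R] (fun x => \int[P]_w G (x, w)).
  exact: (measurable_fun_fubini_tonelli_F G mG G0).
have mIS : measurable_fun [set: R] (fun x => \int[mu]_y S (x, y)).
  exact: (measurable_fun_fubini_tonelli_F (m2 := mu) S mS S0).
apply: ge0_le_integral => //.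
- by move=> x _; exact: integral_ge0.
- move=> x _.
  pose H (z : R * Omega) := (product_kde (joint Y z.2) x * product_kde (joint Y z.2) z.1)%:E.
  have mH : measurable_fun [set: R * Omega] H.
    exact: (measurable_fun_pair2 x mprod).
  have H0 z : 0 <= H z by exact: pkm0.
  rewrite -[leLHS](fubini_tonelli (m1 := mu) (m2 := P) H mH H0).
  have mPH : measurable_fun [set: R] (fun y => \int[P]_w H (y, w)).
    exact: (measurable_fun_fubini_tonelli_F H mH H0).
  have mSx : measurable_fun [set: R] (fun y => S (x, y)).
    exact: (measurable_fun_pair2 x mS).
  apply: ge0_le_integral => //.
  - by move=> y _; exact: integral_ge0.
  - by move=> y _; exact: expectation_product_kde_mul.
Qed.

End estimator_moments.

(** * Products of perturbed factors *)

Section product_inequalities.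
Context (R : realDomainType) (I : Type).
Implicit Types (s : seq I) (a b : I -> R) (W e : R).

Lemma prod_le_expr s a W : (forall i, 0 <= a i) -> (forall i, a i <= W) ->
  \prod_(i <- s) a i <= W ^+ size s.
Proof.
move=> a0 aW; elim: s => [|i s ih]; first by rewrite big_nil expr0.
by rewrite big_cons exprS ler_pM// prodr_ge0.
Qed.

(** Induction on the number of factors: expanding the product, each term other
    than the main one keeps a factor [b i], and the remaining factors are at
    most [W]. *)
Lemma prod_add_le s a b W : 1 <= W -> (forall i, 0 <= a i) -> (forall i, 0 <= b i) ->
  (forall i, a i + b i <= W) ->
  \prod_(i <- s) (a i + b i) <= \prod_(i <- s) a i + W ^+ size s * \sum_(i <- s) b i.
Proof.
move=> W1 a0 b0 abW; have W0 : 0 <= W by apply: le_trans W1.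
elim: s => [|i s ih]; first by rewrite !big_nil mulr0 addr0.
rewrite !big_cons /= mulrDl.
have Pa : 0 <= \prod_(i <- s) a i by apply: prodr_ge0.
have Sb : 0 <= \sum_(i <- s) b i by apply: sumr_ge0.
have h1 : \prod_(i <- s) (a i + b i) <= W ^+ size s.
  by apply: prod_le_expr => // j; apply: addr_ge0.
have h2 : W ^+ size s <= W ^+ (size s).+1 by rewrite ler_weXn2l.
have aW : a i <= W by apply: le_trans (abW i); rewrite lerDl.
apply: (@le_trans _ _ (a i * (\prod_(i <- s) a i + W ^+ size s * \sum_(i <- s) b i) +
   b i * W ^+ (size s).+1)).
  apply: lerD; first by rewrite ler_wpM2l.
  by rewrite ler_wpM2l// (le_trans h1).
rewrite mulrDr -addrA lerD2l mulrDr addrC lerD//; first by rewrite mulrC.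
by rewrite mulrA exprS ler_wpM2r// ler_wpM2r// exprn_ge0.
Qed.

(** Telescoping replaces the factors one by one. With at least two factors each
    error term retains some [a i] or [b i] besides the difference, which is what
    makes the bound integrable when the factors are densities. *)
Lemma prod_dist_le s a b W e : (1 < size s)%N -> 1 <= W -> 0 <= e ->
  (forall i, 0 <= a i) -> (forall i, 0 <= b i) ->
  (forall i, a i <= W) -> (forall i, b i <= W) -> (forall i, `|a i - b i| <= e) ->
  `|\prod_(i <- s) a i - \prod_(i <- s) b i| <=
    e * (2 * W) ^+ size s * \sum_(i <- s) (a i + b i).
Proof.
move=> s1 W1 e0 a0 b0 aW bW ab; have W0 : 0 <= W by apply: le_trans W1.
have W2 : 1 <= 2 * W by rewrite -[leLHS]mul1r ler_pM// ler1n.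
have step i s' : `|\prod_(j <- i :: s') a j - \prod_(j <- i :: s') b j| <=
    e * \prod_(j <- s') a j + b i * `|\prod_(j <- s') a j - \prod_(j <- s') b j|.
  rewrite !big_cons.
  rewrite (_ : _ - _ = (a i - b i) * \prod_(j <- s') a j +
      b i * (\prod_(j <- s') a j - \prod_(j <- s') b j)); last by ring.
  rewrite (le_trans (ler_normD _ _))// !normrM (ger0_norm (b0 i)).
  by rewrite (ger0_norm (_ : 0 <= \prod_(j <- s') a j)) ?prodr_ge0// lerD2r ler_wpM2r// prodr_ge0.
elim: s s1 => // i [|j s] // ih _.
have ab0 k : 0 <= a k + b k by apply: addr_ge0.
pose S := \sum_(k <- j :: s) (a k + b k).
have S0 : 0 <= S by apply: sumr_ge0.
have aS : \prod_(k <- j :: s) a k <= (2 * W) ^+ size (j :: s) * S.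
  rewrite /S !big_cons /= mulrC exprS -mulrA.
  have : \prod_(k <- s) a k <= (2 * W) ^+ size s.
    by apply: prod_le_expr => // k; rewrite (le_trans (aW k))// -[leLHS]mul1r ler_wpM2r// ler1n.
  move=> h; rewrite -[leLHS]mul1r; apply: ler_pM => //.
    by rewrite mulr_ge0// prodr_ge0.
  apply: ler_pM => //; first by rewrite prodr_ge0.
  by rewrite -addrA lerDl addr_ge0// sumr_ge0.
apply: (le_trans (step i (j :: s))).
have Q0 n : 0 <= (2 * W) ^+ n by rewrite exprn_ge0// mulr_ge0.
case: s ih @S S0 aS => [_|k s ih] S S0 aS.
  rewrite !big_seq1 /= !big_cons big_nil addr0.
  have Q1 : 1 <= (2 * W) ^+ 2 by rewrite exprn_ege1.
  apply: (@le_trans _ _ (e * (a j + b i))).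
    by rewrite mulrDr lerD2l mulrC ler_wpM2r.
  rewrite -mulrA ler_wpM2l// -[leLHS]mul1r ler_pM ?addr_ge0//.
  by have := a0 i; have := b0 j; lra.
apply: (@le_trans _ _ (e * ((2 * W) ^+ size [:: j, k & s] * S) +
    W * (e * (2 * W) ^+ size [:: j, k & s] * S))).
  apply: lerD; first by rewrite ler_wpM2l.
  by apply: ler_pM => //; apply: ih.
rewrite [in leRHS]big_cons -/S [in leRHS]exprS.
set Q := (2 * W) ^+ size [:: j, k & s].
have -> : e * (Q * S) + W * (e * Q * S) = e * ((1 + W) * Q) * S by ring.
have Q00 : 0 <= Q by exact: Q0.
apply: ler_pM => //; last by rewrite lerDr.
  by rewrite mulr_ge0// mulr_ge0// addr_ge0.
by rewrite ler_wpM2l// ler_wpM2r// mulrDl mul1r lerD2r.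
Qed.

End product_inequalities.

(** * Mean and variance of the estimated mass *)

Section chebyshev_second_moment.
Local Open Scope ereal_scope.
Context d (Omega : measurableType d) (R : realType) (P : probability Omega R).

(** The second moment is only bounded above, so the variance is recovered from
    [(Z - L)^2 + 2 L Z = Z^2 + L^2], an identity between nonnegative integrands. *)
Lemma chebyshev_second_moment (Z : Omega -> R) (L V eta : R) :
  measurable_fun [set: Omega] Z -> (forall w, 0 <= Z w)%R -> (0 <= L)%R -> (0 < eta)%R ->
  \int[P]_w (Z w)%:E = L%:E -> \int[P]_w ((Z w) ^+ 2)%:E <= (L ^+ 2 + V)%:E ->
  P [set w | (eta <= `|Z w - L|)%R] <= (V / eta ^+ 2)%:E.
Proof.
move=> mZ Z0 L0 eta0 EZ EZ2.
have m1 : measurable_fun [set: Omega] (fun w => ((Z w - L) ^+ 2)%:E).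
  apply/measurable_EFinP; apply: (measurable_funX 2); exact: measurable_funB.
have m2 : measurable_fun [set: Omega] (fun w => (2 * L * Z w)%:E).
  by apply/measurable_EFinP; exact: measurable_funM.
have m3 : measurable_fun [set: Omega] (fun w => (Z w ^+ 2)%:E).
  by apply/measurable_EFinP; apply: (measurable_funX 2).
have V1 : \int[P]_w ((Z w - L) ^+ 2)%:E <= V%:E.
  have : \int[P]_w ((Z w - L) ^+ 2)%:E + (2 * L ^+ 2)%:E <= (2 * L ^+ 2 + V)%:E.
    have -> : (2 * L ^+ 2)%:E = \int[P]_w (2 * L * Z w)%:E.
      under eq_integral do rewrite EFinM.
      rewrite ge0_integralZl_EFin//; last 3 first.
      - by move=> w _; rewrite lee_fin.
      - exact/measurable_EFinP.
      - by rewrite mulr_ge0.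
      by rewrite EZ -EFinM expr2 mulrA.
    rewrite -ge0_integralD//; last 2 first.
    - by move=> w _; rewrite lee_fin sqr_ge0.
    - by move=> w _; rewrite lee_fin !mulr_ge0.
    rewrite (eq_integral (fun w => (Z w ^+ 2)%:E + (L ^+ 2)%:E)); last first.
      by move=> w _; rewrite -!EFinD; congr (_%:E); ring.
    rewrite ge0_integralD//; last 2 first.
    - by move=> w _; rewrite lee_fin sqr_ge0.
    - by move=> w _; rewrite lee_fin sqr_ge0.
    rewrite integral_cst//.
    have -> : (L ^+ 2)%:E * P setT = (L ^+ 2)%:E.
      by rewrite (_ : P setT = 1) ?mule1//; exact: probability_setT.
    have -> : (2 * L ^+ 2 + V)%:E = (L ^+ 2 + V)%:E + (L ^+ 2)%:E.
      by rewrite -EFinD; congr (_%:E); ring.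
    exact: leeD2r.
  by rewrite EFinD addeC leeD2lE.
have mA : measurable [set w | (eta <= `|Z w - L|)%R].
  rewrite -[X in measurable X]setTI.
  have mabs : measurable_fun [set: Omega] (fun w => `|Z w - L|)%R.
    by apply: measurableT_comp => //; exact: measurable_funB.
  have := mabs measurableT _ (measurable_itv `[eta, +oo[).
  by congr (measurable (_ `&` _)); apply/seteqP; split => w /=; rewrite in_itv/= andbT.
have e2 : (0 < eta ^+ 2)%R by rewrite exprn_gt0.
rewrite EFinM lee_pdivlMr// muleC; apply: le_trans V1.
have mI : measurable_fun [set: Omega] (fun w => (\1_[set w | (eta <= `|Z w - L|)%R] w : R)%:E).
  by apply/measurable_EFinP; exact: measurable_indic.
rewrite -[X in P X]setIT -integral_indic// -ge0_integralZl_EFin ?(ltW e2)//.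
apply: ge0_le_integral => //.
- by move=> w _; rewrite mule_ge0// lee_fin ?(ltW e2)//.
- exact: emeasurable_funM.
move=> w _; rewrite -EFinM lee_fin indicE; case: (boolP (w \in _)) => [|_]; last first.
  by rewrite mulr0 sqr_ge0.
rewrite inE/= => h; rewrite mulr1 -(real_normK (num_real (Z w - L))).
by rewrite ler_sqr ?nnegrE ?(ltW eta0).
Qed.

End chebyshev_second_moment.

Section mass_moments.
Context d (Omega : measurableType d) (R : realType) (P : probability Omega R).
Context (K : R -> R) (M : nat) (N : 'I_M -> nat) (h : 'I_M -> R) (p : 'I_M -> R -> R).
Context (X : forall m, 'I_(N m) -> {RV P >-> R}) (B CK W : R).
Hypothesis K_kernel : kernel_assumption K.
Hypothesis X_sample : sample_assumption p X.
Hypotheses (N0 : forall m, (0 < N m)%N) (h0 : forall m, 0 < h m).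
Hypotheses (mp : forall m, measurable_fun [set: R] (p m)) (p0 : forall m x, 0 <= p m x).
Hypotheses (pB : forall m x, p m x <= B) (KC : forall t, K t <= CK).
Hypothesis p1 : forall m, (\int[lebesgue_measure]_x (p m x)%:E = 1)%E.
Hypotheses (M_gt0 : (0 < M)%N) (W1 : 1 <= W) (BW : B <= W).
Let mu := @lebesgue_measure R.

Let m0 : 'I_M := Ordinal M_gt0.

(** The mean of the estimated mass, see [expectation_mass]. *)
Definition smoothed_mass : R := mass (pointwise_prod (fun m => smoothed K (h m) (p m))).

Let s m x := smoothed K (h m) (p m) x.
Let s0 m x : 0 <= s m x. Proof. exact: (smoothed_ge0 K_kernel). Qed.
Let sB m x : s m x <= B. Proof. exact: (smoothed_le K_kernel _ (@mp m) (@p0 m) (@pB m)). Qed.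
Let ms m : measurable_fun [set: R] (s m).
Proof. exact: (measurable_smoothed K_kernel (@mp m) (@p0 m) (@pB m) (h0 m)). Qed.
Let s1 m : (\int[mu]_x (s m x)%:E = 1)%E.
Proof. by rewrite (integral_smoothed K_kernel (@mp m) (@p0 m) (@pB m) (h0 m)) p1. Qed.

Local Open Scope ereal_scope.

Let prod_finite (f : 'I_M -> R -> R) : (forall m x, 0 <= f m x)%R ->
  (forall m x, f m x <= B)%R -> (forall m, measurable_fun [set: R] (f m)) ->
  (forall m, \int[mu]_x (f m x)%:E = 1) ->
  mu.-integrable [set: R] (EFin \o pointwise_prod f).
Proof.
move=> f0 fB mf f1.
have mpf : measurable_fun [set: R] (pointwise_prod f).
  by apply: measurable_prod => m _; exact: mf.
have if0 : mu.-integrable [set: R] (EFin \o f m0).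
  apply/integrableP; split; first by apply/measurable_EFinP; exact: mf.
  have -> : \int[mu]_x `|(EFin \o f m0) x| = 1; last exact: ltry.
  by rewrite -(f1 m0); apply: eq_integral => x _; rewrite gee0_abs ?lee_fin.
have iW : mu.-integrable [set: R] (fun x => (W ^+ M)%:E * (f m0 x)%:E).
  exact: (integrableZl _ _ if0).
apply: (le_integrable _ _ _ iW) => //; first exact/measurable_EFinP.
move=> x _; rewrite -EFinM /= lee_fin ger0_norm ?prodr_ge0// ger0_norm; last first.
  by rewrite mulr_ge0 ?exprn_ge0// (le_trans _ W1).
rewrite /pointwise_prod (bigD1 m0)//= mulrC; apply: ler_wpM2r => //.
rewrite -[X in (_ <= W ^+ X)%R](card_ord M) -[leRHS](prodr_const _ W).
rewrite [leRHS](bigD1 m0)//= -[leLHS]mul1r; apply: ler_pM => //; first exact: prodr_ge0.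
by apply: ler_prod => m _; rewrite f0 (le_trans (fB _ _)).
Qed.

Lemma smoothed_massE :
  \int[mu]_x (\prod_m s m x)%:E = smoothed_mass%:E.
Proof.
rewrite /smoothed_mass /mass /Rintegral fineK//.
exact: (integrable_fin_num _ (prod_finite s0 sB ms s1)).
Qed.

Lemma smoothed_mass_ge0 : (0 <= smoothed_mass)%R.
Proof. by apply: Rintegral_ge0 => x _; apply: prodr_ge0 => m _; exact: s0. Qed.

(** With at least two groups, [prod_dist_le] bounds the difference of the two
    products by a multiple of a sum of densities, whose integral is known. *)
Lemma mass_bias e : (0 <= e)%R -> (forall m x, `|s m x - p m x| <= e)%R ->
  (1 < M)%N ->
  (`|smoothed_mass - mass (pointwise_prod p)| <= e * (2 * W) ^+ M * (2 * M%:R))%R.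
Proof.
move=> e0 se M1.
have i1 := prod_finite s0 sB ms s1.
have i2 := prod_finite p0 pB mp p1.
have W0 : (0 <= W)%R by exact: le_trans W1.
rewrite /smoothed_mass /mass -RintegralB//.
apply: (le_trans (le_normr_Rintegral _ (integrableB _ i1 i2))) => //.
rewrite -lee_fin /Rintegral fineK; last first.
  apply: integrable_fin_num => //; exact: integrable_norm (integrableB _ i1 i2).
have mpr f : (forall m, measurable_fun [set: R] (f m)) ->
    measurable_fun [set: R] (pointwise_prod f).
  by move=> mf; apply: measurable_prod => m _; exact: mf.
have m1 : measurable_fun [set: R]
    (fun x => `|pointwise_prod s x - pointwise_prod p x|%:E).
  by apply/measurable_EFinP; apply: measurableT_comp => //; apply: measurable_funB; exact: mpr.
have msp m : measurable_fun [set: R] (fun x => (s m x + p m x)%:E).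
  by apply/measurable_EFinP; exact: measurable_funD.
have msum : measurable_fun [set: R] (fun x => \sum_m (s m x + p m x)%:E).
  exact: emeasurable_sum.
have m2 : measurable_fun [set: R] (fun x => (e * (2 * W) ^+ M)%:E * \sum_m (s m x + p m x)%:E).
  exact: emeasurable_funM.
have c0 : (0 <= e * (2 * W) ^+ M)%R by rewrite mulr_ge0// exprn_ge0// mulr_ge0.
have sp0 m x : 0 <= (s m x + p m x)%:E by rewrite lee_fin addr_ge0.
apply: (@le_trans _ _ (\int[mu]_x ((e * (2 * W) ^+ M)%:E * \sum_m (s m x + p m x)%:E))).
  apply: ge0_le_integral => // x _; rewrite sumEFin -EFinM lee_fin.
  have := @prod_dist_le R 'I_M (index_enum 'I_M) (s ^~ x) (p ^~ x) W e.
  have -> : size (index_enum 'I_M) = M by rewrite -[RHS]card_ord cardE enumT.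
  apply => // m; first exact: le_trans (sB m x) BW.
  exact: le_trans (pB m x) BW.
rewrite ge0_integralZl_EFin//; last by move=> x _; exact: sume_ge0.
rewrite (ge0_integral_sum mu measurableT msp (fun m x _ => sp0 m x)).
have -> : \sum_m \int[mu]_x (s m x + p m x)%:E = \sum_(m < M) 2%:E.
  apply: eq_bigr => m _; under eq_integral do rewrite EFinD.
  rewrite ge0_integralD//; last 4 first.
  - by move=> x _; rewrite lee_fin.
  - by apply/measurable_EFinP; exact: ms.
  - by move=> x _; rewrite lee_fin.
  - by apply/measurable_EFinP; exact: mp.
  by rewrite s1 p1.
by rewrite sumEFin sumr_const card_ord -EFinM mulr_natr.
Qed.

Let q m x y : R := overlap K (p m) (h m) x y.

(** In the expansion of the product the main term integrates to the square of the
    mean. In every other term one overlap, of integral 1, is kept together with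
    its factor [1 / N m], all others being bounded: this is a variance of order
    [1 / n]. *)
Lemma second_moment_mass :
  (forall m, B ^+ 2 + (N m)%:R^-1 * (CK / h m * B) <= W)%R ->
  \int[mu]_x \int[mu]_y (\prod_m (s m x * s m y + (N m)%:R^-1 * q m x y))%:E <=
  (smoothed_mass ^+ 2 + W ^+ M * \sum_m (N m)%:R^-1)%:E.
Proof.
move=> BNW; have W0 : (0 <= W)%R by exact: le_trans W1.
have q0 m x y : (0 <= q m x y)%R by exact: (overlap_ge0 K_kernel).
have mq m : measurable_fun [set: R * R] (fun z => q m z.1 z.2).
  exact: (measurable_overlap K_kernel (@mp m) (@p0 m) (@pB m) KC (h0 m)).
have qB m x y : (q m x y <= CK / h m * B)%R.
  exact: (overlap_le K_kernel (@mp m) (@p0 m) (@pB m) KC (h0 m)).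
have Ni m : (0 <= (N m)%:R^-1 :> R)%R by rewrite invr_ge0.
pose A (z : R * R) := ((\prod_m s m z.1) * (\prod_m s m z.2))%:E.
pose C m (z : R * R) := (W ^+ M * (N m)%:R^-1)%:E * (q m z.1 z.2)%:E.
have msp : measurable_fun [set: R] (fun x => \prod_m s m x)%R.
  by apply: measurable_prod => m _; exact: ms.
have mA : measurable_fun [set: R * R] A.
  apply/measurable_EFinP; apply: measurable_funM.
    exact: (measurableT_comp msp measurable_fst).
  exact: (measurableT_comp msp measurable_snd).
have mC m : measurable_fun [set: R * R] (C m).
  by apply: emeasurable_funM => //; apply/measurable_EFinP; exact: mq.
have Ps0 x : (0 <= \prod_m s m x)%R by exact: prodr_ge0.
have A0 z : 0 <= A z by rewrite lee_fin mulr_ge0.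
have c0 m : (0 <= W ^+ M * (N m)%:R^-1)%R by rewrite mulr_ge0// exprn_ge0.
have C0 m z : 0 <= C m z by rewrite mule_ge0 ?lee_fin.
have mCs : measurable_fun [set: R * R] (fun z => \sum_m C m z) by exact: emeasurable_sum.
have Cs0 z : 0 <= \sum_m C m z by exact: sume_ge0.
have mAC : measurable_fun [set: R * R] (fun z => A z + \sum_m C m z).
  exact: emeasurable_funD.
have AC0 z : 0 <= A z + \sum_m C m z by rewrite adde_ge0.
pose S (z : R * R) := (\prod_m (s m z.1 * s m z.2 + (N m)%:R^-1 * q m z.1 z.2))%:E.
have S0 z : 0 <= S z.
  by rewrite lee_fin; apply: prodr_ge0 => m _; rewrite addr_ge0// mulr_ge0.
have mS : measurable_fun [set: R * R] S.
  apply/measurable_EFinP; apply: measurable_prod => m _; apply: measurable_funD.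
    apply: measurable_funM; first exact: (measurableT_comp (ms m) measurable_fst).
    exact: (measurableT_comp (ms m) measurable_snd).
  by apply: measurable_funM => //; exact: mq.
have SAC z : S z <= A z + \sum_m C m z.
  have -> : \sum_m C m z = (\sum_m W ^+ M * (N m)%:R^-1 * q m z.1 z.2)%:E.
    by rewrite -sumEFin; apply: eq_bigr => m _; rewrite /C EFinM.
  rewrite /A -EFinD lee_fin -big_split/=.
  apply: (le_trans (prod_add_le (W := W) _ _ _ _ _)) => //.
  - by move=> m; exact: mulr_ge0.
  - by move=> m; exact: mulr_ge0.
  - move=> m; apply: le_trans (BNW m); apply: lerD.
      by rewrite expr2; exact: ler_pM.
    by rewrite ler_wpM2l.
  have -> : size (index_enum 'I_M) = M by rewrite -[RHS]card_ord cardE enumT.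
  by rewrite lerD2l mulr_sumr; apply: ler_sum => m _; rewrite mulrA.
have iA : \int[mu]_x \int[mu]_y A (x, y) = (smoothed_mass ^+ 2)%:E.
  have mE : measurable_fun [set: R] (fun x => (\prod_m s m x)%:E).
    exact/measurable_EFinP.
  have Ps0' x : 0 <= (\prod_m s m x)%:E by rewrite lee_fin.
  transitivity (\int[mu]_x ((\prod_m s m x)%:E * smoothed_mass%:E)).
    apply: eq_integral => x _; rewrite -smoothed_massE -ge0_integralZl//.
  rewrite ge0_integralZr//; last by rewrite lee_fin smoothed_mass_ge0.
  by rewrite smoothed_massE -EFinM expr2.
have iC m : \int[mu]_x \int[mu]_y C m (x, y) = (W ^+ M * (N m)%:R^-1)%:E.
  have mq2 x : measurable_fun [set: R] (fun y => (q m x y)%:E).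
    by apply/measurable_EFinP; exact: (measurable_fun_pair2 x (mq m)).
  have mqE : measurable_fun [set: R * R] (fun z => (q m z.1 z.2)%:E).
    by apply/measurable_EFinP; exact: mq.
  have q0' (z : R * R) : 0 <= (q m z.1 z.2)%:E by rewrite lee_fin.
  have mIq : measurable_fun [set: R] (fun x => \int[mu]_y (q m x y)%:E).
    exact: (measurable_fun_fubini_tonelli_F (m2 := mu) _ mqE q0').
  transitivity (\int[mu]_x ((W ^+ M * (N m)%:R^-1)%:E * \int[mu]_y (q m x y)%:E)).
    apply: eq_integral => x _; rewrite -ge0_integralZl_EFin//.
    - by move=> y _; rewrite lee_fin.
    - exact: mq2.
  rewrite ge0_integralZl_EFin//; last first.
    by move=> x _; apply: integral_ge0 => y _; rewrite lee_fin.
  rewrite (integral_overlap K_kernel (@mp m) (@p0 m) (@pB m) KC (h0 m)).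
  by rewrite p1 mule1.
have mIA : measurable_fun [set: R] (fun x => \int[mu]_y A (x, y)).
  exact: (measurable_fun_fubini_tonelli_F (m2 := mu) A mA A0).
have mIC m : measurable_fun [set: R] (fun x => \int[mu]_y C m (x, y)).
  exact: (measurable_fun_fubini_tonelli_F (m2 := mu) (C m) (mC m) (C0 m)).
have mIS : measurable_fun [set: R] (fun x => \int[mu]_y S (x, y)).
  exact: (measurable_fun_fubini_tonelli_F (m2 := mu) S mS S0).
have IA0 x : 0 <= \int[mu]_y A (x, y) by exact: integral_ge0.
have IC0 m x : 0 <= \int[mu]_y C m (x, y) by exact: integral_ge0.
have mICs : measurable_fun [set: R] (fun x => \sum_m \int[mu]_y C m (x, y)).
  exact: emeasurable_sum.
have ICs0 x : 0 <= \sum_m \int[mu]_y C m (x, y) by exact: sume_ge0.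
have mR : measurable_fun [set: R] (fun x => \int[mu]_y A (x, y) + \sum_m \int[mu]_y C m (x, y)).
  exact: emeasurable_funD.
apply: (@le_trans _ _ (\int[mu]_x (\int[mu]_y A (x, y) + \sum_m \int[mu]_y C m (x, y)))).
  apply: ge0_le_integral => //.
  - by move=> x _; apply: integral_ge0 => y _; exact: (S0 (x, y)).
  - move=> x _.
    have mCx m : measurable_fun [set: R] (fun y => C m (x, y)).
      exact: (measurable_fun_pair2 x (mC m)).
    have mAx : measurable_fun [set: R] (fun y => A (x, y)).
      exact: (measurable_fun_pair2 x mA).
    have mSx : measurable_fun [set: R] (fun y => S (x, y)).
      exact: (measurable_fun_pair2 x mS).
    have mCsx : measurable_fun [set: R] (fun y => \sum_m C m (x, y)).
      exact: (measurable_fun_pair2 x mCs).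
    have mACx : measurable_fun [set: R] (fun y => A (x, y) + \sum_m C m (x, y)).
      exact: (measurable_fun_pair2 x mAC).
    rewrite -(ge0_integral_sum mu measurableT mCx (fun m y _ => C0 m (x, y))).
    rewrite -ge0_integralD//; apply: ge0_le_integral => //.
    - by move=> y _; exact: (S0 (x, y)).
    - by move=> y _; exact: (SAC (x, y)).
rewrite ge0_integralD// iA (ge0_integral_sum mu measurableT mIC (fun m x _ => IC0 m x)).
under eq_bigr do rewrite iC.
by rewrite sumEFin -EFinD mulr_sumr.
Qed.

End mass_moments.

(** * Norms of the sample sizes and power functions *)

Section norms_and_powers.
Context (R : realType).

Lemma powR_dominated (beta c u v : R) : 0 <= beta -> 0 < c -> v < u ->
  exists n0 : nat, forall n : nat, (0 < n)%N -> (n0 <= n)%N ->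
    beta * n%:R `^ (- u) <= c * n%:R `^ (- v).
Proof.
move=> b0 c0 vu; have g0 : 0 < u - v by rewrite subr_gt0.
pose x := (beta / c) `^ (u - v)^-1.
exists (Num.bound x) => n n0 bn; have n0' : (0 : R) < n%:R by rewrite ltr0n.
have xn : x <= n%:R.
  by apply: le_trans (ltW (archi_boundP (powR_ge0 _ _))) _; rewrite ler_nat.
have : beta / c <= n%:R `^ (u - v).
  have -> : beta / c = x `^ (u - v).
    by rewrite /x -powRrM mulVf ?powRr1 ?gt_eqF// divr_ge0// ltW.
  by rewrite ge0_ler_powR ?nnegrE ?powR_ge0// ltW.
rewrite ler_pdivrMr// => h.
have -> : - v = (u - v) - u by ring.
rewrite powRD; last by rewrite (gt_eqF n0') implybT.
by rewrite mulrA ler_wpM2r ?powR_ge0// mulrC.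
Qed.

Context (M : nat) (nrm : 'rV[R]_M -> R).
Hypothesis nrm_norm : is_norm nrm.

Lemma norm_sum_le (I : Type) (s : seq I) (v : I -> 'rV[R]_M) :
  nrm (\sum_(i <- s) v i) <= \sum_(i <- s) nrm (v i).
Proof.
elim: s => [|i s ih]; last first.
  by rewrite !big_cons (le_trans (norm_triangle nrm_norm _ _))// lerD2l.
by rewrite !big_nil -(scale0r (0 : 'rV[R]_M)) (norm_scale nrm_norm) normr0 mul0r.
Qed.

(** The triangle inequality in the canonical basis. *)
Lemma size_norm_le : exists2 c : R, 0 < c & forall (N : 'I_M -> nat) (t : R),
  (forall m, (N m)%:R <= t) -> 0 <= t -> size_norm nrm N <= c * t.
Proof.
exists (1 + \sum_(m < M) nrm (delta_mx 0 m)).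
  by rewrite ltr_wpDr// sumr_ge0// => m _; exact: norm_ge0.
move=> N t Nt t0; rewrite /size_norm [X in nrm X]row_sum_delta.
apply: (le_trans (norm_sum_le _ _)); rewrite mulrDl mul1r ler_wpDl//.
rewrite mulr_suml; apply: ler_sum => m _.
by rewrite (norm_scale nrm_norm) mxE ger0_norm// mulrC ler_wpM2l// (norm_ge0 nrm_norm).
Qed.

Lemma size_norm_gt0 (N : 'I_M -> nat) : (0 < M)%N -> (forall m, (0 < N m)%N) ->
  0 < size_norm nrm N.
Proof.
move=> M0 N0; rewrite lt_def (norm_ge0 nrm_norm) andbT.
apply/eqP => /(norm_eq0 nrm_norm) /rowP /(_ (Ordinal M0)).
by rewrite !mxE => /eqP; rewrite pnatr_eq0 -leqn0 leqNgt N0.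
Qed.

End norms_and_powers.

(** * Deviation of the estimated mass *)

Section deviation.
Context d (Omega : measurableType d) (R : realType) (P : probability Omega R).
Context (K : R -> R) (M : nat) (N : 'I_M -> nat) (h : 'I_M -> R) (p : 'I_M -> R -> R).
Context (X : forall m, 'I_(N m) -> {RV P >-> R}) (B CK W : R).
Hypothesis K_kernel : kernel_assumption K.
Hypothesis X_sample : sample_assumption p X.
Hypotheses (N0 : forall m, (0 < N m)%N) (h0 : forall m, 0 < h m).
Hypotheses (mp : forall m, measurable_fun [set: R] (p m)) (p0 : forall m x, 0 <= p m x).
Hypotheses (pB : forall m x, p m x <= B) (KC : forall t, K t <= CK).
Hypothesis p1 : forall m, (\int[lebesgue_measure]_x (p m x)%:E = 1)%E.
Hypotheses (M_gt0 : (0 < M)%N) (W1 : 1 <= W) (BW : B <= W).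
Hypothesis BNW : forall m, B ^+ 2 + (N m)%:R^-1 * (CK / h m * B) <= W.
Let mu := @lebesgue_measure R.
Let m0 : 'I_M := Ordinal M_gt0.
Local Notation index := {m : 'I_M & 'I_(N m)}.
Let Y (k : index) : {RV P >-> R} := @X (tag k) (tagged k).

Lemma measurable_mass_estimator :
  measurable_fun [set: Omega] (fun w => mass (estimator K h X w)).
Proof.
exact: (measurableT_comp (measurable_mass_product_kde K_kernel N0 h0 KC m0)
  (measurable_joint Y)).
Qed.

Lemma mass_deviation eta : 0 < eta ->
  (P [set w | (eta <= `|mass (estimator K h X w) - smoothed_mass K h p|)%R] <=
   (W ^+ M * (\sum_m (N m)%:R^-1) / eta ^+ 2)%:E)%E.
Proof.
move=> eta0; apply: chebyshev_second_moment => //.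
- exact: measurable_mass_estimator.
- by move=> w; exact: (mass_product_kde_ge0 K_kernel h0 (joint Y w)).
- exact: smoothed_mass_ge0.
- rewrite -(smoothed_massE K_kernel h0 mp p0 pB p1 M_gt0 W1 BW).
  exact: (expectation_mass K_kernel X_sample N0 h0 mp p0 pB KC m0).
- apply: le_trans (second_moment_mass K_kernel h0 mp p0 pB KC p1 M_gt0 W1 BW BNW).
  exact: (expectation_mass_sqr K_kernel X_sample N0 h0 mp p0 pB KC m0).
Qed.

(** For a single group both masses equal 1; otherwise this is [mass_bias]. *)
Lemma mass_bias_le e : 0 <= e -> (forall m x, `|smoothed K (h m) (p m) x - p m x| <= e) ->
  `|smoothed_mass K h p - mass (pointwise_prod p)| <= e * (2 * W) ^+ M * (2 * M%:R).
Proof.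
move=> e0 se; have [M1|M1] := ltnP 1 M.
  exact: (mass_bias K_kernel h0 mp p0 pB p1 M_gt0 W1 BW e0 se M1).
have only m : m = m0.
  by apply/val_inj => /=; case: m => i /= iM; case: i iM => // i iM; have := leq_trans iM M1.
have pwE (f : 'I_M -> R -> R) x : pointwise_prod f x = f m0 x.
  rewrite /pointwise_prod (bigD1 m0)//= big1 ?mulr1// => m.
  by rewrite (only m) eqxx.
have mass1 (f : 'I_M -> R -> R) : (\int[mu]_x (f m0 x)%:E = 1)%E ->
    mass (pointwise_prod f) = 1.
  move=> f1; rewrite /mass /Rintegral (_ : \int[_]_x _ = 1)%E//.
  by rewrite -f1; apply: eq_integral => x _; rewrite pwE.
rewrite /smoothed_mass !mass1//; last first.
  by rewrite (integral_smoothed K_kernel (@mp m0) (@p0 m0) (@pB m0) (h0 m0)) p1.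
rewrite subrr normr0 !mulr_ge0// exprn_ge0// mulr_ge0// (le_trans _ W1)//.
Qed.

End deviation.

(** * Probability of the good event *)

Section concentration.
Context (R : realType).

Lemma bounded_derivatives (M : nat) (p : 'I_M -> R -> R) (s : nat) :
  (forall m, density_assumption (p m)) -> (s <= 3)%N ->
  exists2 B : R, 0 < B & forall m x, `|derive1n s (p m) x| <= B.
Proof.
move=> hp s3.
have /choice[B HB] : forall m, exists B : R, 0 < B /\ forall x, `|derive1n s (p m) x| <= B.
  move=> m; have [_ _ /(_ s s3)[+ _]] := hp m.
  move=> /ex_strict_bound_gt0[B B0 hB]; exists B; split => // x.
  exact/ltW/hB.
exists (1 + \sum_m B m).
  by rewrite ltr_wpDr// sumr_ge0// => m _; have [/ltW] := HB m.
move=> m x; have [_ /(_ x)/le_trans] := HB m; apply.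
rewrite (bigD1 m)//= addrCA lerDl addr_ge0// sumr_ge0// => i _.
by have [/ltW] := HB i.
Qed.

Context (d : measure_display) (Omega : measurableType d) (P : probability Omega R).
Context (M : nat) (nrm : 'rV[R]_M -> R) (p : 'I_M -> R -> R) (K : R -> R).
Context (N : nat -> 'I_M -> nat) (h : nat -> 'I_M -> R) (alpha0 alpha : R).
Context (X : forall (n : nat) (m : 'I_M), 'I_(N n m) -> {RV P >-> R}).
Hypotheses (M_ge1 : (1 <= M)%N) (nrm_norm : is_norm nrm).
Hypothesis p_density : forall m, density_assumption (p m).
Hypothesis lambda_gt0 : 0 < mass (pointwise_prod p).
Hypothesis K_kernel : kernel_assumption K.
Hypothesis scaling : scaling_assumption N h alpha0.
Hypothesis X_sample : forall n, (0 < n)%N -> sample_assumption p (@X n).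
Hypothesis alpha_bounds : Num.max (1 - 4 * alpha0) 0 < alpha < 1.

Let mp m : measurable_fun [set: R] (p m). Proof. by have [[]] := p_density m. Qed.
Let p0 m x : 0 <= p m x. Proof. by have [[]] := p_density m. Qed.
Let p1 m : (\int[lebesgue_measure]_x (p m x)%:E = 1)%E.
Proof. by have [[]] := p_density m. Qed.

Lemma sample_size_gt0 n m : (0 < n)%N -> (0 < N n m)%N.
Proof.
move=> n0; have [D1 [D2 [/andP[D10 _] /(_ n m n0)/andP[h1 _]]]] := scaling_size scaling.
have : 0 < (N n m)%:R / n%:R :> R by apply: lt_le_trans h1.
by rewrite ltr_pdivlMr ?ltr0n// mul0r ltr0n.
Qed.

Let normN n := size_norm nrm (N n).
Let Z n w := mass (estimator K (h n) (@X n) w).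
Let lambda := mass (pointwise_prod p).

Lemma measurable_mass n : (0 < n)%N -> measurable_fun [set: Omega] (Z n).
Proof.
move=> n0; have [CK KC] := kernel_bounded K_kernel.
apply: (measurable_mass_estimator _ K_kernel (CK := CK)) => //.
- by move=> m; exact: sample_size_gt0.
- by move=> m; exact: (scaling_bandwidth_gt0 scaling).
- by move=> t; have /andP[] := KC t.
Qed.

Lemma measurable_mass_dist n c (i : interval R) : (0 < n)%N ->
  measurable [set w | `|Z n w - c| \in i].
Proof.
move=> n0; have mabs : measurable_fun [set: Omega] (fun w => `|Z n w - c|).
  by apply: measurableT_comp => //; apply: measurable_funB => //; exact: measurable_mass.
by rewrite -[X in measurable X]setTI; exact: (mabs measurableT _ (measurable_itv i)).
Qed.

Lemma measurable_good_event n : (0 < n)%N ->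
  measurable (good_event (pointwise_prod p) (estimator K (h n) (@X n)) alpha (normN n)).
Proof.
move=> n0; have := measurable_mass_dist lambda
  `]-oo, lambda / normN n `^ ((1 - alpha) / 2)] n0.
by congr measurable; apply/seteqP; split => w /=; rewrite in_itv.
Qed.

Lemma size_norm_linear : exists2 c : R, 0 < c &
  forall n, (0 < n)%N -> 0 < normN n <= c * n%:R.
Proof.
have [c c0 hc] := size_norm_le nrm_norm.
have [D1 [D2 [/andP[D10 D12] hD]]] := scaling_size scaling.
have D20 : 0 < D2 by apply: lt_trans D12.
exists (c * D2); first exact: mulr_gt0.
move=> n n0; rewrite size_norm_gt0//=; last by move=> m; exact: sample_size_gt0.
rewrite -mulrA; apply: hc => [m|]; last by rewrite mulr_ge0// ltW.
by have /andP[_] := hD n m n0; rewrite ler_pdivrMr ?ltr0n.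
Qed.

(** Each bandwidth is of order [n ^ (- alpha0)] and the bias of each smoothing is
    quadratic in it. *)
Lemma smoothed_mass_bias : exists2 beta : R, 0 <= beta & forall n, (0 < n)%N ->
  `|smoothed_mass K (h n) p - lambda| <= beta * n%:R `^ (- (2 * alpha0)).
Proof.
have [B B0 pB] := bounded_derivatives p_density (leq0n 3).
have [B2 B20 p2B] := bounded_derivatives p_density (isT : (2 <= 3)%N).
have pB' m x : p m x <= B by apply: le_trans (ler_norm _) (pB m x).
have [D1 [D2 [/andP[D10 D12] hD]]] := scaling_size scaling.
have [A1 [A2 [A10 A20 hA]]] := scaling_bandwidth scaling.
have /andP[a00 _] := scaling_exponent scaling.
pose m2 := \int[lebesgue_measure]_t (t ^+ 2 * K t).
have m20 : 0 <= m2.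
  by apply: Rintegral_ge0 => t _; rewrite mulr_ge0 ?sqr_ge0 ?(kernel_ge0 K_kernel).
pose W := Num.max 1 B.
have W1 : 1 <= W by rewrite le_max lexx.
have BW : B <= W by rewrite le_max lexx orbT.
pose e n : R := B2 * (A2 ^+ 2 * D1 `^ (- (2 * alpha0)) * n%:R `^ (- (2 * alpha0))) * m2.
have e0 n : 0 <= e n by rewrite !mulr_ge0 ?sqr_ge0 ?powR_ge0// ltW.
exists (B2 * (A2 ^+ 2 * D1 `^ (- (2 * alpha0))) * m2 * (2 * W) ^+ M * (2 * M%:R)).
  have Wn : 0 <= (2 * W) ^+ M by rewrite exprn_ge0// mulr_ge0// (le_trans _ W1).
  have AD : 0 <= A2 ^+ 2 * D1 `^ (- (2 * alpha0)) by rewrite mulr_ge0 ?sqr_ge0 ?powR_ge0.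
  by apply: mulr_ge0; [apply: mulr_ge0 => //; apply: mulr_ge0 => //; apply: mulr_ge0 => //;
      exact: ltW|exact: mulr_ge0].
move=> n n0; have nR : (0 : R) < n%:R by rewrite ltr0n.
have h0 m : 0 < h n m by exact: (scaling_bandwidth_gt0 scaling).
have h2 m : h n m ^+ 2 <= A2 ^+ 2 * D1 `^ (- (2 * alpha0)) * n%:R `^ (- (2 * alpha0)).
  have /andP[_ hle] := hA n m n0.
  have /andP[Dle _] := hD n m n0; rewrite ler_pdivlMr// in Dle.
  rewrite -mulrA -powRM ?(ltW D10) ?(ltW nR)//.
  have -> : - (2 * alpha0) = (- alpha0) * 2%:R by ring.
  rewrite powRrM powR_mulrn ?powR_ge0// -exprMn ler_sqr ?nnegrE ?(ltW (h0 m))//; last first.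
    by rewrite mulr_ge0 ?powR_ge0// ltW.
  apply: (le_trans hle); rewrite ler_pM2l// !powRN lef_pV2 ?posrE ?powR_gt0 ?mulr_gt0//.
    by rewrite ge0_ler_powR ?nnegrE ?(ltW a00) ?mulr_ge0// ltW.
  by rewrite ltr0n sample_size_gt0.
have se m x : `|smoothed K (h n m) (p m) x - p m x| <= e n.
  have [_ [dp _] _] := p_density m.
  have := @smoothed_bias _ _ K_kernel (p m) B B2 (h n m) x (@mp m) (@p0 m) (@pB' m).
  move=> /(_ (fun y => dp 0 y isT) (fun y => dp 1 y isT) (p2B m) (h0 m)).
  move=> /le_trans; apply; rewrite /e ler_wpM2r// ler_wpM2l// ltW//.
have := mass_bias_le K_kernel h0 mp p0 pB' p1 M_ge1 W1 BW (e0 n) se.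
by move=> /le_trans; apply; rewrite /e le_eqVlt; apply/orP; left; apply/eqP; ring.
Qed.

(** Once [h m * N m >= 1], the bounds [CK * B / (h m * N m)] on the overlaps
    divided by the sample sizes are uniform in [n]. *)
Lemma mass_deviation_linear : exists2 V : R, 0 <= V & exists n1 : nat,
  forall n, (0 < n)%N -> (n1 <= n)%N -> forall eta, 0 < eta ->
  (P [set w | (eta <= `|Z n w - smoothed_mass K (h n) p|)%R] <=
   (V / n%:R / eta ^+ 2)%:E)%E.
Proof.
have [B B0 pB] := bounded_derivatives p_density (leq0n 3).
have pB' m x : p m x <= B by apply: le_trans (ler_norm _) (pB m x).
have [CK KC] := kernel_bounded K_kernel.
have KC' t : K t <= CK by have /andP[] := KC t.
(* The bound [W] must exceed [B] and, when [1 <= h n m * N n m], also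
   [B ^ 2 + (N n m)^-1 * (CK / h n m * B)]. *)
have CK0 : 0 <= CK by have /andP[] := KC 0; exact: le_trans.
have [D1 [D2 [/andP[D10 D12] hD]]] := scaling_size scaling.
pose W := Num.max 1 (B + B ^+ 2 + CK * B).
have W1 : 1 <= W by rewrite le_max lexx.
have CKB : 0 <= CK * B by rewrite mulr_ge0// ltW.
have BW : B <= W by rewrite le_max -addrA lerDl addr_ge0 ?sqr_ge0// orbT.
exists (W ^+ M * (M%:R / D1)).
  by rewrite mulr_ge0 ?exprn_ge0 ?divr_ge0 ?(ltW D10)// (le_trans _ W1).
have : \forall n \near \oo, forall m, 1 <= h n m * (N n m)%:R.
  apply: filter_forall => m; by have /cvgryPge/(_ 1) := scaling_limit scaling m.
case=> n1 _ hn1; exists n1 => n n0 n1n eta eta0.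
have h0 m : 0 < h n m by exact: (scaling_bandwidth_gt0 scaling).
have N0 m : (0 < N n m)%N by exact: sample_size_gt0.
have BNW m : B ^+ 2 + (N n m)%:R^-1 * (CK / h n m * B) <= W.
  have hN := hn1 n n1n m.
  apply: (@le_trans _ _ (B ^+ 2 + CK * B)); last first.
    by rewrite le_max -addrA [X in _ || X](_ : _ = true) ?orbT// lerDr ltW.
  rewrite lerD2l (_ : (N n m)%:R^-1 * _ = CK * B / (h n m * (N n m)%:R)); last first.
    by field; rewrite !gt_eqF ?ltr0n.
  by rewrite ler_pdivrMr ?mulr_gt0 ?ltr0n// -[leLHS]mulr1 ler_wpM2l.
have := mass_deviation K_kernel (X_sample n0) N0 h0 mp p0 pB' KC' p1 M_ge1 W1 BW BNW eta0.
move=> /le_trans; apply; rewrite lee_fin ler_pM2r ?invr_gt0 ?exprn_gt0//.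
rewrite -mulrA ler_wpM2l ?exprn_ge0 ?(le_trans _ W1)//.
rewrite -[X in X%:R / D1]card_ord -sum1_card natr_sum !mulr_suml.
apply: ler_sum => m _; rewrite mul1r -invfM lef_pV2 ?posrE ?mulr_gt0 ?ltr0n//.
by have /andP[+ _] := hD n m n0; rewrite ler_pdivlMr ?ltr0n.
Qed.

(** As [alpha > 1 - 4 alpha0], the bias is eventually at most half of the
    tolerance defining the event, and Chebyshev applied to the other half gives a
    probability of order [n^-1 r ^ (1 - alpha)], where the norm [r] of the sample
    sizes is at most linear in [n]. The remaining finitely many [n] are absorbed in
    the constant. *)
Lemma good_event_probability : exists C : R, forall n, (0 < n)%N ->
  ((1 - C * normN n `^ (- alpha))%:E <=
   P (good_event (pointwise_prod p) (estimator K (h n) (@X n)) alpha (normN n)))%E.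
Proof.
have [cr cr0 hr] := size_norm_linear.
have [V V0 [n1 hV]] := mass_deviation_linear.
have [beta beta0 hbeta] := smoothed_mass_bias.
have /andP[] := alpha_bounds; rewrite gt_max => /andP[al4 al0] al1.
pose a := (1 - alpha) / 2.
have a0 : 0 < a by rewrite divr_gt0// subr_gt0.
have a2 : a < 2 * alpha0 by rewrite /a; lra.
have c0 : 0 < lambda / 2 * cr `^ (- a) by rewrite mulr_gt0 ?powR_gt0 ?divr_gt0.
have [n2 hn2] := powR_dominated beta0 c0 a2.
pose n3 := maxn n1 n2.
pose C1 := V * cr * 4 / lambda ^+ 2.
have C10 : 0 <= C1 by rewrite divr_ge0 ?sqr_ge0// !mulr_ge0// ltW.
(* With this constant the claimed lower bound is at most 0 for all [n < n3]. *)
pose C2 := (cr * n3%:R) `^ alpha.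
have C20 : 0 <= C2 by exact: powR_ge0.
exists (C1 + C2) => n n0; set E := good_event _ _ _ _.
have /andP[r0 rn] := hr n n0; have nR : (0 : R) < n%:R by rewrite ltr0n.
have mE : measurable E by exact: measurable_good_event.
have ra0 : 0 < normN n `^ (- alpha) by exact: powR_gt0.
have [nn3|nn3] := ltnP n n3.
  apply: (@le_trans _ _ 0%E) => //; rewrite lee_fin subr_le0.
  apply: (@le_trans _ _ (C2 * normN n `^ (- alpha))); last first.
    by rewrite ler_wpM2r ?(ltW ra0)// lerDr.
  rewrite powRN ler_pdivlMr ?powR_gt0// mul1r ge0_ler_powR ?nnegrE ?(ltW al0) ?(ltW r0)//.
    by rewrite mulr_ge0// ltW.
  by apply: (le_trans rn); rewrite ler_pM2l// ler_nat ltnW.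
have [nn1 nn2] : (n1 <= n)%N /\ (n2 <= n)%N.
  by split; apply: leq_trans nn3; rewrite ?leq_maxl ?leq_maxr.
pose eta := lambda / 2 * normN n `^ (- a).
have eta0 : 0 < eta by rewrite mulr_gt0 ?powR_gt0 ?divr_gt0.
have biasn : `|smoothed_mass K (h n) p - lambda| <= eta.
  apply: (le_trans (hbeta n n0)); apply: (le_trans (hn2 n n0 nn2)).
  rewrite /eta -mulrA ler_pM2l ?divr_gt0// -powRM ?(ltW cr0) ?(ltW nR)//.
  rewrite !powRN lef_pV2 ?posrE ?powR_gt0 ?mulr_gt0//.
  by rewrite ge0_ler_powR ?nnegrE ?(ltW a0) ?(ltW r0)// mulr_ge0// ltW.
have EC : (P (~` E) <= (C1 * normN n `^ (- alpha))%:E)%E.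
  apply: (@le_trans _ _ (P [set w | (eta <= `|Z n w - smoothed_mass K (h n) p|)%R])).
    apply: le_measure; rewrite ?inE//.
    - exact: measurableC.
    - have := measurable_mass_dist (smoothed_mass K (h n) p) `[eta, +oo[ n0.
      by congr measurable; apply/seteqP; split => w /=; rewrite in_itv/= andbT.
    - move=> w /= /negP; rewrite -ltNge => lt.
      have E2 : lambda / normN n `^ ((1 - alpha) / 2) = 2 * eta.
        by rewrite /eta powRN -/a; field; rewrite gt_eqF// powR_gt0.
      rewrite E2 in lt.
      have := ler_normD (Z n w - smoothed_mass K (h n) p) (smoothed_mass K (h n) p - lambda).
      rewrite addrA subrK => tri.
      have : 2 * eta < `|Z n w - lambda| by exact: lt.
      lra.
  apply: (le_trans (hV n n0 nn1 eta eta0)); rewrite lee_fin.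
  have -> : V / n%:R / eta ^+ 2 = V * 4 / lambda ^+ 2 * (n%:R^-1 * normN n `^ (1 - alpha)).
    have -> : normN n `^ (1 - alpha) = (normN n `^ a) ^+ 2.
      by rewrite -powR_mulrn ?powR_ge0// -powRrM; congr (_ `^ _); rewrite /a; field.
    by rewrite /eta powRN; field; rewrite !gt_eqF ?powR_gt0.
  have -> : C1 * normN n `^ (- alpha) = V * 4 / lambda ^+ 2 * (cr * normN n `^ (- alpha)).
    by rewrite /C1; ring.
  apply: ler_wpM2l; first by rewrite divr_ge0 ?sqr_ge0// mulr_ge0.
  rewrite powRD; last by rewrite (gt_eqF r0) implybT.
  rewrite powRr1 ?(ltW r0)// mulrA ler_pM2r// ler_pdivrMl//.
  by rewrite mulrC.
have -> : P E = (1 - P (~` E))%E by rewrite -probability_setC ?setCK//; exact: measurableC.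
rewrite EFinB; apply: leeB => //; apply: (le_trans EC).
by rewrite lee_fin ler_wpM2r ?(ltW ra0)// lerDl.
Qed.

End concentration.

(** * First moment of the product of the estimates *)

Section lebesgue_shift.
Context (R : realType).
Let mu := @lebesgue_measure R.
Local Open Scope ereal_scope.

Lemma integral_shift (f : R -> \bar R) (t : R) : measurable_fun [set: R] f ->
  \int[mu]_x f (x + t)%R = \int[mu]_x f x.
Proof.
move=> mf; rewrite integralE [RHS]integralE.
have mp : measurable_fun [set: R] f^\+ by exact: measurable_funepos.
have mn : measurable_fun [set: R] f^\- by exact: measurable_funeneg.
rewrite -(ge0_integral_shift t mp)// -(ge0_integral_shift t mn)//.
by congr (_ - _); apply: eq_integral => x _; rewrite ?funeposE ?funenegE.
Qed.

End lebesgue_shift.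

Section first_moment.
Context (R : realType) (K : R -> R) (M : nat) (N : 'I_M -> nat) (h : 'I_M -> R) (CK : R).
Hypothesis K_kernel : kernel_assumption K.
Hypotheses (N0 : forall m, (0 < N m)%N) (h0 : forall m, 0 < h m).
Hypotheses (KC : forall t, K t <= CK) (M_gt0 : (0 < M)%N).
Let mu := @lebesgue_measure R.
Let m0 : 'I_M := Ordinal M_gt0.
Local Notation index := {m : 'I_M & 'I_(N m)}.
Local Notation pk := (product_kde K h).
Implicit Type v : index -> R.
Local Open Scope ereal_scope.

Lemma integral_abs_scaled (b u : R) : (0 < b)%R ->
  \int[mu]_x (`|x| * scaled K b (x - u))%:E < +oo.
Proof.
move=> b0; pose F (x : R) := (`|x| * scaled K b (x - u))%:E.
have K0 := kernel_ge0 K_kernel.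
have mK := kernel_measurable K_kernel.
have mF : measurable_fun [set: R] F.
  apply/measurable_EFinP; apply: measurable_funM; first exact: normr_measurable.
  by apply: (measurableT_comp (measurable_scaled K_kernel b)); exact: measurable_funB.
have F0 x : 0 <= F x by rewrite lee_fin mulr_ge0// scaled_ge0.
have := ge0_integral_pos_affine u b0 mF F0.
move=> /(congr1 (mule b%:E)); rewrite muleA -EFinM divff ?gt_eqF// mul1e => <-.
apply: lte_mul_pinfty; rewrite ?lee_fin ?(ltW b0)//.
pose G1 (y : R) := (`|y| ^+ 1 * K y)%:E.
pose G0 (y : R) := (`|y| ^+ 0 * K y)%:E.
have mG k : measurable_fun [set: R] (fun y : R => (`|y| ^+ k * K y)%:E).
  apply/measurable_EFinP; apply: measurable_funM => //.
  exact: (measurableT_comp (@exprn_measurable R setT k) (@normr_measurable R setT)).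
have G0' k y : 0 <= (`|y| ^+ k * K y)%:E by rewrite lee_fin mulr_ge0// exprn_ge0.
have mR1 : measurable_fun [set: R] (fun y => 1%:E * G1 y) by apply: emeasurable_funM => //;
    exact: mG.
have mR0 : measurable_fun [set: R] (fun y => (`|u| / b)%:E * G0 y).
  by apply: emeasurable_funM => //; exact: mG.
have p1 y : 0 <= 1%:E * G1 y by rewrite mule_ge0//; exact: G0'.
have p0 y : 0 <= (`|u| / b)%:E * G0 y.
  by rewrite mule_ge0//; [rewrite lee_fin divr_ge0// ltW|exact: G0'].
have mR : measurable_fun [set: R] (fun y => 1%:E * G1 y + (`|u| / b)%:E * G0 y).
  exact: emeasurable_funD.
have mFa : measurable_fun [set: R] (fun y => F (b * y + u)%R).
  by apply: (measurableT_comp mF); apply: measurable_funD => //; exact: measurable_funM.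
apply: (@le_lt_trans _ _ (\int[mu]_y (1%:E * G1 y + (`|u| / b)%:E * G0 y))).
  apply: ge0_le_integral => // y _.
  rewrite /F /G1 /G0 -!EFinM -EFinD lee_fin expr0 mul1r mul1r expr1 /scaled.
  rewrite addrK (_ : b * y / b = y)%R; last by field; rewrite gt_eqF.
  rewrite mulrA -mulrDl ler_wpM2r// ler_pdivrMr// mulrDl divfK ?gt_eqF//.
  by rewrite (le_trans (ler_normD _ _))// lerD2r normrM (gtr0_norm b0) mulrC.
have mom k : (k <= 3)%N -> \int[mu]_y (`|y| ^+ k * K y)%:E < +oo.
  by move=> k3; have := kernel_moments K_kernel k3.
have c0 : (0 <= `|u| / b)%R by rewrite divr_ge0// ltW.
rewrite ge0_integralD//.
apply: lte_add_pinfty; (rewrite ge0_integralZl_EFin//; [|by move=> y _; exact: G0'|exact: mG]).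
  by rewrite mul1e; exact: mom.
by apply: lte_mul_pinfty => //; exact: mom.
Qed.

Let pk_ge0 v x : (0 <= pk v x)%R. Proof. exact: (product_kde_ge0 K_kernel h0). Qed.

Let mpk v : measurable_fun [set: R] (pk v).
Proof. exact: (measurable_product_kde_at h K_kernel v). Qed.

Lemma integrable_first_moment v : mu.-integrable [set: R] (fun x => (x * pk v x)%:E).
Proof.
have mx : measurable_fun [set: R] (fun x => x * pk v x)%R by exact: measurable_funM.
apply/integrableP; split; first exact/measurable_EFinP.
pose c := (\prod_(m < M | m != m0) (CK / h m) * (N m0)%:R^-1)%R.
pose a (i : 'I_(N m0)) x := (`|x| * scaled K (h m0) (x - data v i))%:E.
have CK0 : (0 <= CK)%R by exact: le_trans (kernel_ge0 K_kernel 0%R) (KC 0%R).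
have c0 : (0 <= c)%R.
  by rewrite mulr_ge0 ?invr_ge0//; apply: prodr_ge0 => m _; rewrite divr_ge0// ltW.
have a0 i x : 0 <= a i x by rewrite lee_fin mulr_ge0// scaled_ge0.
have ma i : measurable_fun [set: R] (a i).
  apply/measurable_EFinP; apply: measurable_funM; first exact: normr_measurable.
  by apply: (measurableT_comp (measurable_scaled K_kernel (h m0))); exact: measurable_funB.
have mas : measurable_fun [set: R] (fun x => \sum_(i < N m0) a i x) by exact: emeasurable_sum.
have as0 x : 0 <= \sum_(i < N m0) a i x by exact: sume_ge0.
have mr : measurable_fun [set: R] (fun x => c%:E * \sum_(i < N m0) a i x).
  exact: emeasurable_funM.
have ml : measurable_fun [set: R] (fun x => `|(x * pk v x)%:E|).
  by apply: measurableT_comp => //; exact/measurable_EFinP.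
apply: (@le_lt_trans _ _ (\int[mu]_x (c%:E * \sum_(i < N m0) a i x))).
  apply: ge0_le_integral => // x _.
  rewrite sumEFin -EFinM lee_fin normrM (ger0_norm (pk_ge0 v x)).
  apply: le_trans (ler_wpM2l (normr_ge0 x) (product_kde_le K_kernel h0 KC m0 v x)) _.
  rewrite kdeE -[X in (_ <= _ * X)%R](mulr_sumr _ _ _ `|x|%R) /c.
  by rewrite le_eqVlt; apply/orP; left; apply/eqP; ring.
rewrite ge0_integralZl_EFin//.
rewrite (ge0_integral_sum mu measurableT ma (fun i x _ => a0 i x)).
apply: lte_mul_pinfty => //; apply: lte_sum_pinfty => i _.
exact: integral_abs_scaled.
Qed.

(** The integral of [x * product_kde K h v x], split into its two nonnegative
    parts so that measurability in [v] follows from Tonelli. *)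
Definition first_moment v : R :=
  (mass (fun x => Num.max x 0 * pk v x) - mass (fun x => Num.max (- x) 0 * pk v x))%R.

Let integrable_part v (g : R -> R) : measurable_fun [set: R] g ->
  (forall x, `|g x| <= `|x|)%R -> mu.-integrable [set: R] (fun x => (g x * pk v x)%:E).
Proof.
move=> mg gx; have mgx : measurable_fun [set: R] (fun x => g x * pk v x)%R.
  exact: measurable_funM.
apply: (le_integrable _ _ _ (integrable_first_moment v)) => //; first exact/measurable_EFinP.
by move=> x _; rewrite /= lee_fin !normrM ler_wpM2r.
Qed.

Let maxr_le (x : R) : (`|Num.max x 0| <= `|x|)%R.
Proof. by case: (leP x 0%R) => // _; rewrite normr0. Qed.

Let maxrN_le (x : R) : (`|Num.max (- x) 0| <= `|x|)%R.
Proof. by rewrite -[leRHS]normrN; exact: maxr_le. Qed.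

Let mmax : measurable_fun [set: R] (fun x : R => Num.max x 0)%R.
Proof. exact: measurable_maxr. Qed.

Let mmaxN : measurable_fun [set: R] (fun x : R => Num.max (- x) 0)%R.
Proof. exact: measurable_maxr. Qed.

Lemma first_momentE v : first_moment v = (\int[mu]_x (x * pk v x))%R.
Proof.
rewrite /first_moment /mass -RintegralB//; last 2 first.
- exact: integrable_part.
- exact: integrable_part.
apply: eq_Rintegral => x _; rewrite -mulrBl; congr (_ * _)%R.
have /orP[x0|x0] := le_total 0%R x.
  by rewrite max_l// max_r ?oppr_le0// subr0.
by rewrite max_r// max_l ?oppr_ge0// sub0r opprK.
Qed.

Lemma integrable_product_kde v : mu.-integrable [set: R] (EFin \o pk v).
Proof.
apply/integrableP; split; first by apply/measurable_EFinP; exact: mpk.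
have -> : \int[mu]_x `|(EFin \o pk v) x| = \int[mu]_x (pk v x)%:E.
  by apply: eq_integral => x _; rewrite gee0_abs ?lee_fin.
exact: le_lt_trans (integral_product_kde_le K_kernel N0 h0 KC m0 v) (ltry _).
Qed.

Lemma product_kde_shift v t x : pk (fun k => v k + t)%R x = pk v (x - t)%R.
Proof.
apply: eq_bigr => m _; rewrite !kdeE; congr (_ * _)%R; apply: eq_bigr => i _.
by congr (scaled _ _ _); rewrite /data; ring.
Qed.

Lemma mass_shift v t : mass (pk (fun k => v k + t)%R) = mass (pk v).
Proof.
rewrite /mass /Rintegral; congr fine.
have m1 : measurable_fun [set: R] (fun x => (pk v x)%:E).
  by apply/measurable_EFinP; exact: mpk.
rewrite -(integral_shift (- t) m1).
by apply: eq_integral => x _; rewrite product_kde_shift.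
Qed.

(** A common translation of the samples moves the first moment at constant speed
    [mass (product_kde K h v)]; so at most one translate of a configuration has a
    prescribed ratio of first moment to mass. *)
Lemma first_moment_shift v t :
  first_moment (fun k => v k + t)%R = (first_moment v + t * mass (pk v))%R.
Proof.
rewrite !first_momentE /mass -RintegralZl//; last exact: integrable_product_kde.
rewrite -RintegralD//; last 2 first.
- exact: integrable_first_moment.
- by apply: (integrableZl _ _ (integrable_product_kde v)).
have m1 : measurable_fun [set: R] (fun x => (x * pk v (x - t))%:E).
  apply/measurable_EFinP; apply: measurable_funM => //.
  by apply: (measurableT_comp (mpk v)); exact: measurable_funB.
rewrite /Rintegral; congr fine.
transitivity (\int[mu]_x (x * pk v (x - t))%:E).
  by apply: eq_integral => x _; rewrite product_kde_shift.
rewrite -(integral_shift t m1); apply: eq_integral => x _.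
by rewrite addrK mulrDl.
Qed.

Lemma measurable_first_moment : measurable_fun [set: config R index] first_moment.
Proof.
have H (g : R -> R) : measurable_fun [set: R] g -> (forall x, 0 <= g x)%R ->
    (forall x, `|g x| <= `|x|)%R ->
    measurable_fun [set: config R index] (fun v => mass (fun x => g x * pk v x)%R).
  move=> mg g0 gx; apply/measurable_EFinP.
  have -> : EFin \o (fun v => mass (fun x => g x * pk v x)%R) =
      (fun v => \int[mu]_x (g x * pk v x)%:E).
    apply/funext => v /=; rewrite /mass /Rintegral fineK//.
    exact: integrable_fin_num (integrable_part v mg gx).
  apply: (measurable_fun_fubini_tonelli_G (m1 := mu)
    (fun z : R * config R index => (g z.1 * pk z.2 z.1)%:E)) => [|z].
    apply/measurable_EFinP; apply: measurable_funM.
      exact: (measurableT_comp mg measurable_fst).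
    exact: measurable_product_kde.
  by rewrite lee_fin mulr_ge0.
apply: measurable_funB; apply: H => // x; by rewrite le_max lexx orbT.
Qed.

End first_moment.

(** * Positivity and finiteness of the integrated squared error *)

Section integrated_squared_error.
Context d (Omega : measurableType d) (R : realType) (P : probability Omega R).
Context (K : R -> R) (M : nat) (N : 'I_M -> nat) (h : 'I_M -> R) (p : 'I_M -> R -> R).
Context (X : forall m, 'I_(N m) -> {RV P >-> R}) (B CK : R).
Hypothesis K_kernel : kernel_assumption K.
Hypothesis X_sample : sample_assumption p X.
Hypotheses (N0 : forall m, (0 < N m)%N) (h0 : forall m, 0 < h m).
Hypotheses (mp : forall m, measurable_fun [set: R] (p m)) (p0 : forall m x, 0 <= p m x).
Hypotheses (pB : forall m x, p m x <= B) (KC : forall t, K t <= CK).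
Hypothesis p1 : forall m, (\int[lebesgue_measure]_x (p m x)%:E = 1)%E.
Hypothesis cp : forall m, continuous (p m).
Hypothesis (M_gt0 : (0 < M)%N).
Hypothesis lambda_gt0 : 0 < mass (pointwise_prod p).
Let mu := @lebesgue_measure R.
Let m0 : 'I_M := Ordinal M_gt0.
Local Notation index := {m : 'I_M & 'I_(N m)}.
Local Notation pk := (product_kde K h).
Implicit Type v : index -> R.
Let Y (k : index) : {RV P >-> R} := @X (tag k) (tagged k).
Let f := normalized (pointwise_prod p).
Let Z v := mass (pk v).
Let J v := ISE f (normalized (pk v)).
Local Open Scope ereal_scope.

Let pk_ge0 v x : (0 <= pk v x)%R. Proof. exact: (product_kde_ge0 K_kernel h0). Qed.

Let mpk v : measurable_fun [set: R] (pk v).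
Proof. exact: (measurable_product_kde_at h K_kernel v). Qed.

Let mpst : measurable_fun [set: R] (pointwise_prod p).
Proof. by apply: measurable_prod => m _; exact: mp. Qed.

Let mf : measurable_fun [set: R] f. Proof. exact: measurable_funM. Qed.

Let pst0 x : (0 <= pointwise_prod p x)%R. Proof. by apply: prodr_ge0 => m _. Qed.

Let f0 x : (0 <= f x)%R.
Proof. by rewrite /f /normalized mulr_ge0 ?invr_ge0 ?(ltW lambda_gt0). Qed.

Let mZ : measurable_fun [set: config R index] Z.
Proof. exact: (measurable_mass_product_kde K_kernel N0 h0 KC m0). Qed.

Let Z0 v : (0 <= Z v)%R. Proof. exact: (mass_product_kde_ge0 K_kernel h0). Qed.

(** The configurations whose normalized estimate has mean [kappa]. *)
Definition moment_event kappa : set (config R index) :=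
  [set v | (0 < Z v)%R /\ first_moment K h v = (kappa * Z v)%R].

Lemma measurable_moment_event kappa : measurable (moment_event kappa).
Proof.
have -> : moment_event kappa =
    (Z @^-1` `]0%R, +oo[) `&` ((fun v => first_moment K h v - kappa * Z v)%R @^-1` [set 0%R]).
  apply/seteqP; split => v /=; rewrite in_itv/= andbT.
    by move=> [z0 ->]; rewrite subrr.
  by move=> [z0 /eqP]; rewrite subr_eq0 => /eqP.
apply: measurableI; rewrite -[X in measurable X]setTI.
  exact: (mZ measurableT (measurable_itv _)).
have mD : measurable_fun [set: config R index] (fun v => first_moment K h v - kappa * Z v)%R.
  apply: measurable_funB; first exact: (measurable_first_moment K_kernel h0 KC M_gt0).
  exact: measurable_funM.
exact: (mD measurableT _ (measurable_set1 0%R)).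
Qed.

Lemma moment_event_null kappa : P (joint Y @^-1` moment_event kappa) = 0.
Proof.
apply: (translation_null (f := fun k : index => p (tag k)) X_sample.2 _ _ _
  (measurable_moment_event kappa)) => //.
- by move=> k; exact: X_sample.1.
- by move=> k; rewrite p1 ltry.
move=> y; have [z0|z0] := ltP 0%R (Z y).
  rewrite (_ : [set t | _] = [set (kappa - first_moment K h y / Z y)%R]) ?lebesgue_measure_set1//.
  apply/seteqP; split => t /=; rewrite /moment_event /= /Z (mass_shift _ K_kernel) -/(Z y)
      (first_moment_shift K_kernel N0 h0 KC M_gt0) -/(Z y).
    by move=> [_ E]; apply: (mulIf (lt0r_neq0 z0)); rewrite mulrBl divfK ?gt_eqF// -E; ring.
  by move=> ->; split => //; rewrite mulrBl divfK ?gt_eqF//; ring.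
rewrite (_ : [set t | _] = set0) ?measure0//; apply/seteqP; split => t //=.
by rewrite /moment_event /= /Z (mass_shift _ K_kernel) -/(Z y) => -[]; rewrite ltNge z0.
Qed.

(** If the error vanishes, the normalized estimate equals the normalized target
    almost everywhere and has the same mean. *)
Lemma ISE_eq0_first_moment v : (0 < Z v)%R -> J v = 0 ->
  first_moment K h v = ((mass (fun x => Num.max x 0 * f x) -
    mass (fun x => Num.max (- x) 0 * f x)) * Z v)%R.
Proof.
move=> z0 Jv0.
have mg : measurable_fun [set: R] (normalized (pk v)) by exact: measurable_funM.
have mJ : measurable_fun [set: R] (fun x => ((normalized (pk v) x - f x) ^+ 2)%:E).
  by apply/measurable_EFinP; apply: (measurable_funX 2); exact: measurable_funB.
have : \int[mu]_x `|((normalized (pk v) x - f x) ^+ 2)%:E| = 0.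
  by rewrite -[RHS]Jv0; apply: eq_integral => x _; rewrite gee0_abs// lee_fin sqr_ge0.
move=> /(ae_eq_integral_abs mu measurableT mJ) fg.
have mom (g : R -> R) : measurable_fun [set: R] g -> (forall x, 0 <= g x)%R ->
    mass (fun x => g x * pk v x)%R = (mass (fun x => g x * f x) * Z v)%R.
  move=> mg' g0.
  have m1 : measurable_fun [set: R] (fun x => (g x * pk v x)%:E).
    by apply/measurable_EFinP; exact: measurable_funM.
  have m2 : measurable_fun [set: R] (fun x => (g x * f x)%:E).
    by apply/measurable_EFinP; exact: measurable_funM.
  have m3 : measurable_fun [set: R] (fun x => (Z v)%:E * (g x * f x)%:E).
    exact: emeasurable_funM.
  rewrite /mass /Rintegral.
  have -> : \int[mu]_x (g x * pk v x)%:E = (Z v)%:E * \int[mu]_x (g x * f x)%:E.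
    rewrite -ge0_integralZl_EFin//; last by move=> x _; rewrite lee_fin mulr_ge0.
    apply: ge0_ae_eq_integral => //.
    - by move=> x _; rewrite lee_fin mulr_ge0.
    - by move=> x _; rewrite mule_ge0// lee_fin// mulr_ge0.
    apply: filterS fg => x /= /(_ I) [] /eqP; rewrite sqrf_eq0 subr_eq0 => /eqP <- _.
    rewrite -EFinM /normalized -/(Z v); congr (_%:E); field; exact: lt0r_neq0.
  have : 0 <= \int[mu]_x (g x * f x)%:E.
    by apply: integral_ge0 => x _; rewrite lee_fin mulr_ge0.
  (* An infinite integral would have the default value 0 on both sides. *)
  case: (\int[mu]_x (g x * f x)%:E) => [r| |]//= _; first by rewrite mulrC.
  by rewrite mulry gtr0_sg// mul1e mul0r.
have m1 : measurable_fun [set: R] (fun x : R => Num.max x 0)%R by exact: measurable_maxr.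
have m2 : measurable_fun [set: R] (fun x : R => Num.max (- x) 0)%R by exact: measurable_maxr.
have max0 (x : R) : (0 <= Num.max x 0)%R by rewrite le_max lexx orbT.
by rewrite /first_moment (mom _ m1)// (mom _ m2)// mulrBl.
Qed.

Lemma measurable_ISE : measurable_fun [set: config R index] J.
Proof.
apply: (measurable_fun_fubini_tonelli_G (m1 := mu)
  (fun z : R * config R index => ((normalized (pk z.2) z.1 - f z.1) ^+ 2)%:E)) => [|z].
  apply/measurable_EFinP; apply: (measurable_funX 2); apply: measurable_funB.
    apply: measurable_funM; last exact: measurable_product_kde.
    have mZi : measurable_fun [set: config R index] (fun v => (Z v)^-1)%R.
      have -> : (fun v => (Z v)^-1)%R = (fun v => Z v `^ (-1))%R.
        by apply/funext => v; rewrite powR_inv1.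
      exact: (measurableT_comp (@measurable_powR R (-1)%R) mZ).
    exact: (measurableT_comp mZi measurable_snd).
  exact: (measurableT_comp mf measurable_fst).
by rewrite lee_fin sqr_ge0.
Qed.

(** [(g - f)^2 <= 2 g^2 + 2 f^2], and both functions are bounded and integrable. *)
Lemma ISE_le v : (0 < Z v)%R ->
  J v <= (2 * (\prod_m (CK / h m)) / Z v + 2 * B ^+ M / mass (pointwise_prod p))%:E.
Proof.
move=> z0; set c := (\prod_m (CK / h m))%R; set lam := mass _.
have CK0 : (0 <= CK)%R by exact: le_trans (kernel_ge0 K_kernel 0%R) (KC 0%R).
have B0 : (0 <= B)%R by exact: le_trans (p0 m0 0%R) (pB m0 0%R).
have c0 : (0 <= c)%R by apply: prodr_ge0 => m _; rewrite divr_ge0// ltW.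
have lam0 : (0 < lam)%R by [].
have pkc x : (pk v x <= c)%R.
  apply: ler_prod => m _; apply/andP; split; first exact: (kde_ge0 K_kernel).
  exact: (kde_le K_kernel).
have pstB x : (pointwise_prod p x <= B ^+ M)%R.
  rewrite -[X in (_ <= _ ^+ X)%R](card_ord M) -[leRHS](prodr_const _ B).
  by apply: ler_prod => m _; rewrite p0 pB.
have Ipk : \int[mu]_x (pk v x)%:E = (Z v)%:E.
  by rewrite (mass_product_kdeE K_kernel N0 h0 KC m0).
have Ipst : \int[mu]_x (pointwise_prod p x)%:E = lam%:E.
  have : 0 <= \int[mu]_x (pointwise_prod p x)%:E.
    by apply: integral_ge0 => x _; rewrite lee_fin.
  move: lam0; rewrite /lam /mass /Rintegral.
  by case: (\int[mu]_x (pointwise_prod p x)%:E) => [r| |]//=; rewrite ltxx.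
(* The constants for which [2 g^2 <= a * product_kde] and
   [2 f^2 <= b * pointwise_prod p], one power of each function being replaced by
   its upper bound. *)
pose a := (2 * c / Z v ^+ 2)%R; pose b := (2 * B ^+ M / lam ^+ 2)%R.
have a0 : (0 <= a)%R by rewrite divr_ge0 ?sqr_ge0// mulr_ge0.
have b0 : (0 <= b)%R by rewrite divr_ge0 ?sqr_ge0// mulr_ge0// exprn_ge0.
have m1 : measurable_fun [set: R] (fun x => (pk v x)%:E) by apply/measurable_EFinP; exact: mpk.
have m2 : measurable_fun [set: R] (fun x => (pointwise_prod p x)%:E).
  exact/measurable_EFinP.
have m1a : measurable_fun [set: R] (fun x => a%:E * (pk v x)%:E) by exact: emeasurable_funM.
have m2b : measurable_fun [set: R] (fun x => b%:E * (pointwise_prod p x)%:E).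
  exact: emeasurable_funM.
have m12 : measurable_fun [set: R] (fun x => a%:E * (pk v x)%:E + b%:E * (pointwise_prod p x)%:E).
  exact: emeasurable_funD.
have mJ : measurable_fun [set: R] (fun x => ((normalized (pk v) x - f x) ^+ 2)%:E).
  apply/measurable_EFinP; apply: (measurable_funX 2); apply: measurable_funB => //.
  exact: measurable_funM.
have p1a x : 0 <= a%:E * (pk v x)%:E by rewrite mule_ge0// lee_fin.
have p2b x : 0 <= b%:E * (pointwise_prod p x)%:E by rewrite mule_ge0// lee_fin.
apply: (@le_trans _ _ (\int[mu]_x (a%:E * (pk v x)%:E + b%:E * (pointwise_prod p x)%:E))).
  apply: ge0_le_integral => //.
  - by move=> x _; rewrite lee_fin sqr_ge0.
  - move=> x _; rewrite -!EFinM -EFinD lee_fin.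
    have h1 : (2 * normalized (pk v) x ^+ 2 <= a * pk v x)%R.
      rewrite /normalized -/(Z v) exprMn exprVn.
      rewrite (_ : 2 * _ = 2 * pk v x / Z v ^+ 2 * pk v x)%R; last by field; exact: lt0r_neq0.
      by rewrite ler_wpM2r// ler_wpM2r ?invr_ge0 ?sqr_ge0// ler_wpM2l.
    have h2 : (2 * f x ^+ 2 <= b * pointwise_prod p x)%R.
      rewrite /f /normalized -/lam exprMn exprVn.
      rewrite (_ : 2 * _ = 2 * pointwise_prod p x / lam ^+ 2 * pointwise_prod p x)%R; last first.
        by field; exact: lt0r_neq0.
      by rewrite ler_wpM2r// ler_wpM2r ?invr_ge0 ?sqr_ge0// ler_wpM2l.
    apply: le_trans (lerD h1 h2).
    have := sqr_ge0 (normalized (pk v) x + f x)%R; nra.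
rewrite ge0_integralD// !ge0_integralZl_EFin//; try by move=> x _; rewrite lee_fin.
rewrite Ipk Ipst -!EFinM -EFinD lee_fin le_eqVlt; apply/orP; left; apply/eqP.
by rewrite /a /b; field; rewrite !lt0r_neq0.
Qed.

Lemma ISE_ge0 v : 0 <= J v.
Proof. by apply: integral_ge0 => x _; rewrite lee_fin sqr_ge0. Qed.

Lemma measurable_ISE_data : measurable_fun [set: Omega] (fun w => J (joint Y w)).
Proof. exact: (measurableT_comp measurable_ISE (measurable_joint Y)). Qed.

(** A zero integral would confine [E], up to a null set, to the configurations
    whose normalized estimate has the mean of the target; those form a null set. *)
Lemma integral_ISE_gt0 (E : set Omega) : measurable E -> 0 < P E ->
  (forall w, E w -> 0 < Z (joint Y w))%R -> 0 < \int[P]_(w in E) J (joint Y w).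
Proof.
move=> mE PE EZ; rewrite lt_neqAle integral_ge0 ?andbT; last by move=> w _; exact: ISE_ge0.
apply/negP => /eqP/esym I0.
have mJ : measurable_fun E (fun w => J (joint Y w)).
  exact: measurable_funTS measurable_ISE_data.
have : \int[P]_(w in E) `|J (joint Y w)| = 0.
  by rewrite -[RHS]I0; apply: eq_integral => w _; rewrite gee0_abs// ISE_ge0.
move=> /(ae_eq_integral_abs P mE mJ) [S [mS S0 HS]].
set kappa := (mass (fun x => Num.max x 0 * f x) - mass (fun x => Num.max (- x) 0 * f x))%R.
pose A := moment_event kappa.
have mA : measurable (joint Y @^-1` A).
  rewrite -[X in measurable X]setTI; apply: (measurable_joint Y) => //.
  exact: measurable_moment_event.
have : P E <= P (S `|` joint Y @^-1` A).
  apply: le_measure; rewrite ?inE//; first exact: measurableU.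
  move=> w Ew; have [wS|wS] := pselect (S w); first by left.
  right; split; first exact: EZ.
  apply: ISE_eq0_first_moment; first exact: EZ.
  apply: contrapT => Jw; apply: wS; apply: HS => /= /(_ Ew); exact: Jw.
rewrite leNgt => /negP; apply; apply: le_lt_trans PE.
apply: (le_trans (measureU2 _ _ _)) => //.
by rewrite [X in X + _]S0 [X in _ + X](moment_event_null kappa) adde0.
Qed.

End integrated_squared_error.

(** * Comparison of the two functionals *)

(** The normalisation cancels and a weighted integral lies between the bounds of
    its weight. In the extended reals the quotient is only meaningful when the
    unweighted integral is positive and finite. *)
Lemma weighted_ratio_bounds d (Omega : measurableType d) (R : realType)
    (P : probability Omega R) (E : set Omega) (J : Omega -> \bar R) (q : Omega -> R)
    (l u : R) :
  measurable E -> measurable_fun [set: Omega] J -> (forall w, 0 <= J w)%E ->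
  measurable_fun [set: Omega] q -> 0 <= l -> (forall w, E w -> l <= q w <= u) ->
  (0 < \int[P]_(w in E) J w)%E -> (\int[P]_(w in E) J w < +oo)%E -> (0 < P E)%E ->
  exists2 r : R, l <= r <= u &
    (((P E)^-1 * \int[P]_(w in E) ((q w)%:E * J w)) /
     ((P E)^-1 * \int[P]_(w in E) J w))%E = r%:E.
Proof.
move=> mE mJ J0 mq l0 lqu I0 Ioo PE0.
have mJE : measurable_fun E J by exact: measurable_funTS mJ.
have mqJ : measurable_fun E (fun w => (q w)%:E * J w)%E.
  by apply: emeasurable_funM => //; apply/measurable_EFinP; exact: measurable_funTS mq.
have [w Ew] : E !=set0.
  by apply/set0P; apply: contraTneq PE0 => ->; rewrite measure0 ltxx.
have u0 : 0 <= u by have /andP[lq qu] := lqu w Ew; exact: le_trans l0 (le_trans lq qu).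
have lo : (l%:E * \int[P]_(w in E) J w <= \int[P]_(w in E) ((q w)%:E * J w))%E.
  rewrite -ge0_integralZl_EFin//; apply: ge0_le_integral => //.
  - by move=> v _; rewrite mule_ge0.
  - exact: emeasurable_funM.
  - by move=> v Ev; rewrite lee_wpmul2r// lee_fin; have /andP[] := lqu v Ev.
have hi : (\int[P]_(w in E) ((q w)%:E * J w) <= u%:E * \int[P]_(w in E) J w)%E.
  rewrite -ge0_integralZl_EFin//; apply: ge0_le_integral => //.
  - move=> v Ev; rewrite mule_ge0// lee_fin; have /andP[+ _] := lqu v Ev.
    exact: le_trans.
  - exact: emeasurable_funM.
  - by move=> v Ev; rewrite lee_wpmul2r// lee_fin; have /andP[] := lqu v Ev.
have Poo : (P E < +oo)%E by apply: le_lt_trans (probability_le1 P mE) (ltry _).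
move: PE0 Poo I0 Ioo lo hi.
case: (P E) => [a| |]//; rewrite lte_fin => a0 _.
case: (\int[P]_(w in E) J w)%E => [b| |]//; rewrite lte_fin => b0 _.
case: (\int[P]_(w in E) ((q w)%:E * J w))%E => [c| |]//; rewrite -!EFinM !lee_fin => lb bu.
exists (c / b); first by rewrite ler_pdivlMr// lb ler_pdivrMr.
rewrite inver gt_eqF// -!EFinM inver gt_eqF ?mulr_gt0 ?invr_gt0//.
by rewrite -EFinM; congr (_%:E); field; rewrite !gt_eqF.
Qed.

Lemma powRN_lt (R : realType) (r b delta : R) : 0 < b -> 0 < delta ->
  delta^-1 `^ b^-1 < r -> r `^ (- b) < delta.
Proof.
move=> b0 d0 lt; have r0 : 0 < r by apply: le_lt_trans lt; exact: powR_ge0.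
rewrite powRN invf_plt ?posrE ?powR_gt0//.
have -> : delta^-1 = (delta^-1 `^ b^-1) `^ b.
  by rewrite -powRrM mulVf ?gt_eqF// powRr1// invr_ge0 ltW.
by rewrite gt0_ltr_powR// nnegrE ?powR_ge0// ltW.
Qed.

Theorem proposition4p5 (R : realType) (d : measure_display)
    (Omega : measurableType d) (P : probability Omega R)
    (M : nat) (M_ge1 : (1 <= M)%N)
    (nrm : 'rV[R]_M -> R) (nrm_norm : is_norm nrm)
    (p : 'I_M -> R -> R)
    (p_density : forall m, density_assumption (p m))
    (lambda_gt0 : 0 < mass (pointwise_prod p))
    (K : R -> R) (K_kernel : kernel_assumption K)
    (N : nat -> 'I_M -> nat) (h : nat -> 'I_M -> R) (alpha0 : R)
    (scaling : scaling_assumption N h alpha0)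
    (X : forall (n : nat) (m : 'I_M), 'I_(N n m) -> {RV P >-> R})
    (X_sample : forall n, (0 < n)%N -> sample_assumption p (X n))
    (alpha : R) (alpha_bounds : Num.max (1 - 4 * alpha0) 0 < alpha < 1) :
  let pstar := pointwise_prod p in
  let pstarhat n := estimator K (h n) (X n) in
  let normN n := size_norm nrm (N n) in
  let Omega_ n := good_event pstar (pstarhat n) alpha (normN n) in
  (exists C : R, forall n, (0 < n)%N ->
     ((1 - C * normN n `^ (- alpha))%:E <= P (Omega_ n))%E) /\
  (MISEbar P pstar (pstarhat n) (Omega_ n) / MISE P pstar (pstarhat n) (Omega_ n))%E
    @[n --> tends_to_infinity normN] --> 1%:E.
Proof.
move=> pstar pstarhat normN Omega_.
have [C HC] := good_event_probability M_ge1 nrm_norm p_density lambda_gt0 K_kernel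
  scaling X_sample alpha_bounds.
split; first by exists C.
have /andP[] := alpha_bounds; rewrite gt_max => /andP[_ al0] al1.
pose a := (1 - alpha) / 2.
have a0 : 0 < a by rewrite divr_gt0// subr_gt0.
have [B B0 pB] := bounded_derivatives p_density (leq0n 3).
have pB' m x : p m x <= B by apply: le_trans (ler_norm _) (pB m x).
have [CK KC] := kernel_bounded K_kernel.
have KC' t : K t <= CK by have /andP[] := KC t.
have mp m : measurable_fun [set: R] (p m) by have [[]] := p_density m.
have p0 m x : 0 <= p m x by have [[]] := p_density m.
have p1 m : (\int[lebesgue_measure]_x (p m x)%:E = 1)%E by have [[]] := p_density m.
have cp m : continuous (p m).
  have [_ [dp _] _] := p_density m => x.
  by apply: differentiable_continuous; apply/derivable1_diffP; exact: (dp 0 x isT).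
have ratio n : (0 < n)%N -> normN n `^ (- a) < 1 -> (0 < P (Omega_ n))%E ->
    exists2 r : R, (1 - normN n `^ (- a)) ^+ 2 <= r <= (1 + normN n `^ (- a)) ^+ 2 &
    (MISEbar P pstar (pstarhat n) (Omega_ n) / MISE P pstar (pstarhat n) (Omega_ n))%E = r%:E.
  move=> n0 e1 PE; set e := normN n `^ (- a) in e1 *.
  have e0 : 0 <= e by exact: powR_ge0.
  have N0 m : (0 < N n m)%N by exact: (sample_size_gt0 scaling).
  have h0 m : 0 < h n m by exact: (scaling_bandwidth_gt0 scaling).
  have Xs := X_sample n n0.
  have mE : measurable (Omega_ n).
    exact: (measurable_good_event nrm p alpha X M_ge1 K_kernel scaling n0).
  set lam := mass pstar.
  have EZ w : Omega_ n w -> lam * (1 - e) <= mass (pstarhat n w) <= lam * (1 + e).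
    rewrite /Omega_ /good_event /= -/a -/lam.
    have -> : lam / normN n `^ a = lam * e by rewrite /e powRN.
    by rewrite ler_distl mulrBr mulrDr mulr1.
  have EZ0 w : Omega_ n w -> 0 < mass (pstarhat n w).
    by move=> /EZ /andP[+ _]; apply: lt_le_trans; rewrite mulr_gt0// subr_gt0.
  rewrite /MISEbar /MISE; apply: weighted_ratio_bounds => //.
  - exact: (measurable_ISE_data (X n) K_kernel N0 h0 mp KC' M_ge1).
  - by move=> w; apply: integral_ge0 => x _; rewrite lee_fin sqr_ge0.
  - apply: (measurable_funX 2); apply: measurable_funM => //.
    exact: (measurable_mass X M_ge1 K_kernel scaling n0).
  - exact: sqr_ge0.
  - move=> w /EZ /andP[lo hi]; rewrite -/lam.
    have h1 : 1 - e <= mass (pstarhat n w) / lam by rewrite ler_pdivlMr// mulrC.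
    have h2 : mass (pstarhat n w) / lam <= 1 + e by rewrite ler_pdivrMr// mulrC.
    have h3 : 0 <= 1 - e by rewrite subr_ge0 ltW.
    have h4 : 0 <= mass (pstarhat n w) / lam by exact: le_trans h1.
    have h5 : 0 <= 1 + e by exact: addr_ge0.
    by rewrite !ler_sqr ?nnegrE // h1 h2.
  - exact: (integral_ISE_gt0 K_kernel Xs N0 h0 mp p0 KC' p1 cp M_ge1 lambda_gt0 mE PE EZ0).
  - pose c := 2 * (\prod_m (CK / h n m)) / (lam * (1 - e)) + 2 * B ^+ M / lam.
    have z0 : 0 < lam * (1 - e) by rewrite mulr_gt0// subr_gt0.
    have CK0 : 0 <= CK by have /andP[] := KC 0; exact: le_trans.
    have c0 : 0 <= \prod_m (CK / h n m) by apply: prodr_ge0 => m _; rewrite divr_ge0// ltW.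
    have J0 w : (0 <= ISE (normalized pstar) (normalized (pstarhat n w)))%E.
      by apply: integral_ge0 => x _; rewrite lee_fin sqr_ge0.
    apply: (@le_lt_trans _ _ (\int[P]_(w in Omega_ n) (cst c%:E) w)%E).
      apply: ge0_le_integral => //.
      - apply: measurable_funTS.
        exact: (measurable_ISE_data (X n) K_kernel N0 h0 mp KC' M_ge1).
      - move=> w Ew; pose v := joint (fun k : {m : 'I_M & 'I_(N n m)} => X n (tag k) (tagged k))
          w.
        apply: le_trans (@ISE_le _ _ _ _ _ _ _ _ K_kernel N0 h0 mp p0 pB' KC' M_ge1 lambda_gt0 v
            (EZ0 w Ew)) _.
        rewrite lee_fin lerD2r ler_wpM2l ?mulr_ge0// lef_pV2 ?posrE ?(EZ0 w Ew)//.
        by have /andP[] := EZ w Ew.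
    rewrite integral_cst//; apply: lte_mul_pinfty => //.
      rewrite lee_fin /c; apply: addr_ge0; apply: divr_ge0; rewrite ?(ltW z0) ?(ltW lambda_gt0)//.
        exact: mulr_ge0.
      by rewrite mulr_ge0// exprn_ge0// ltW.
    exact: le_lt_trans (probability_le1 P mE) (ltry _).
move=> A /= /nbhs_EFin /nbhs_ballP[eps /= eps0 HA].
pose delta := Num.min 1 (eps / 3).
have delta0 : 0 < delta by rewrite lt_min ltr01 divr_gt0.
pose C' := Num.max C 1.
have C'0 : 0 < C' by rewrite lt_max ltr01 orbT.
(* Beyond [T] the tolerance is below [delta] and the event has positive
   probability. *)
pose T := Num.max (delta^-1 `^ a^-1) (C'^-1^-1 `^ alpha^-1).
exists T => // n /= [n0]; rewrite gt_max => /andP[T1 T2].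
have e_lt : normN n `^ (- a) < delta by exact: powRN_lt.
have p_lt : normN n `^ (- alpha) < C'^-1 by apply: powRN_lt => //; rewrite invr_gt0.
have PE : (0 < P (Omega_ n))%E.
  apply: lt_le_trans (HC n n0); rewrite lte_fin subr_gt0.
  apply: (@le_lt_trans _ _ (C' * normN n `^ (- alpha))).
    by rewrite ler_wpM2r ?powR_ge0// le_max lexx.
  by rewrite -ltr_pdivlMl// mulr1.
have e1 : normN n `^ (- a) < 1 by apply: lt_le_trans e_lt _; rewrite ge_min lexx.
have e3 : normN n `^ (- a) < eps / 3 by apply: lt_le_trans e_lt _; rewrite ge_min lexx orbT.
have [r /andP[lo hi] ->] := ratio n n0 e1 PE.
apply: HA; rewrite /ball /= ltr_distl.
have := powR_ge0 (normN n) (- a); move: lo hi e1 e3; move: (normN n `^ (- a)) => e.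
move=> lo hi e1 e3 e0.
have ee : e ^+ 2 <= e by rewrite expr2 -[leRHS]mulr1 ler_wpM2l// ltW.
by apply/andP; split; move: lo hi; rewrite !sqrrD ?sqrrN; nra.
Qed.
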